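(* Let $G$ be a (discrete) FC-hypercentral group, $\sigma$ a two-cocycle on $G$, and $H$ a normal subgroup of $G$. Assume that $H$ is prime and $\sigma$-regular in $G$. Consider the following two conditions: (i) $(H,\sigma)$ and $(C_G^\sigma(H),\sigma)$ are both $C^*$-simple. (ii) $(G,\sigma)$ is $C^*$-simple. Then (i) implies (ii). If we also assume that $C_G^\sigma(H)$ is prime and $\sigma$-regular in $G$, then (ii) implies (i).
   Context: A two-cocycle on a discrete group $G$ (identity $e$) is a map $\sigma\colon G\times G\to\mathbb{T}$ (unit circle) with $\sigma(g,h)\sigma(gh,k)=\sigma(g,hk)\sigma(h,k)$ and $\sigma(g,e)=\sigma(e,g)=1$ for all $g,h,k\in G$. Its restriction to a subgroup is again denoted $\sigma$. The operators $\lambda_\sigma(g)$ on $\ell^2(G)$ are given by $(\lambda_\sigma(g)\xi)(h)=\sigma(g,g^{-1}h)\xi(g^{-1}h)$. $C^*_r(G,\sigma)$ is the $C^*$-subalgebra of $B(\ell^2(G))$ generated by $\lambda_\sigma(G)$. $(G,\sigma)$ is $C^*$-simple if $C^*_r(G,\sigma)$ is simple. For $H\le G$, an element $g\in G$ is $\sigma$-regular w.r.t. $H$ if $\sigma(g,h)=\sigma(h,g)$ whenever $h\in H$ and $gh=hg$. A subgroup $H$ of $G$ is $\sigma$-regular in $G$ if every $h\in H$ that is $\sigma$-regular w.r.t. $H$ is also $\sigma$-regular w.r.t. $G$. $C_G^\sigma(H)=\{g\in C_G(H): \sigma(g,h)=\sigma(h,g)\text{ for all }h\in H\}$, where $C_G(H)$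 is the centralizer of $H$ in $G$; it is a subgroup of $G$. A group is prime if it has no finite normal subgroup except the trivial one; equivalently, its FC-center (the subgroup of elements with finite conjugacy class) is torsion-free. A group is icc if every conjugacy class of a non-identity element is infinite; a group is FC-hypercentral if it has no icc quotient group other than the trivial one. *)

(* Defs.v *)
From HB Require Import structures.
From mathcomp Require Import all_boot all_order all_algebra.
From mathcomp Require Import complex.
From mathcomp Require Import boolp classical_sets functions cardinality fsbigop.
From mathcomp Require Import reals ereal esum.
From mathcomp Require Import ring lra.

Set Implicit Arguments.
Unset Strict Implicit.
Unset Printing Implicit Defensive.

Import Order.TTheory GRing.Theory Num.Theory ComplexField Normc.

Local Open Scope classical_set_scope.
Local Open Scope ring_scope.

Section Groups.
Local Open Scope group_scope.

Definition is_normal (G : groupType) (N : groupClosed G) : Prop :=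
  forall n g : G, n \in N -> n ^ g \in N.

Record subgrp (G : groupType) (H : groupClosed G) := SubGrp {
  subgrp_val :> G;
  subgrp_valP : subgrp_val \in H
}.

HB.instance Definition _ (G : groupType) (H : groupClosed G) :=
  [isSub for @subgrp_val G H].
HB.instance Definition _ (G : groupType) (H : groupClosed G) :=
  [Choice of subgrp H by <:].

Lemma subgrp_closed (G : groupType) (H : groupClosed G) :
  group_closed (fun x : G => x \in H).
Proof. by split=> [|x y Hx Hy]; [exact: gpred1 | exact: gpredF]. Qed.

HB.instance Definition _ (G : groupType) (H : groupClosed G) :=
  SubChoice_isSubGroup.Build G (fun x : G => x \in H) (subgrp H)
    (@subgrp_closed G H).

Definition prime_group (G : groupType) : Prop :=
  forall N : groupClosed G,
    is_normal N -> finite_set [set x : G | x \in N] ->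
    forall x : G, x \in N -> x = 1.

Definition conj_class (G : groupType) (x : G) : set G :=
  [set x ^ g | g in [set: G]].

Definition icc (G : groupType) : Prop :=
  forall x : G, x != 1 -> infinite_set (conj_class x).

(* The quotients of [G] are taken, up to isomorphism, to be the groups [Q]
   with a surjective homomorphism from [G]. *)
Definition FC_hypercentral (G : groupType) : Prop :=
  forall (Q : groupType) (f : {multiplicative G -> Q}),
    (forall y : Q, exists x : G, f x = y) ->
    icc Q -> forall y : Q, y = 1.

End Groups.

Section Cocycles.
Local Open Scope group_scope.

Record two_cocycle (R : realType) (G : groupType) := TwoCocycle {
  cocycle_fun :> G -> G -> R[i];
  cocycle_norm : forall g h, `|cocycle_fun g h|%R = 1%R;
  cocycle_eq : forall g h k,
    (cocycle_fun g h * cocycle_fun (g * h)%g k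
     = cocycle_fun g (h * k)%g * cocycle_fun h k)%R;
  cocycle_g1 : forall g, cocycle_fun g 1 = 1%R;
  cocycle_1g : forall g, cocycle_fun 1 g = 1%R
}.

Variables (R : realType) (G : groupType) (sigma : two_cocycle R G).

Section Restriction.
Variable H : groupClosed G.

Definition restr_fun (g h : subgrp H) : R[i] := sigma (val g) (val h).

Fact restr_norm g h : `|restr_fun g h|%R = 1%R.
Proof. exact: cocycle_norm. Qed.

Fact restr_eq g h k :
  (restr_fun g h * restr_fun (g * h)%g k
   = restr_fun g (h * k)%g * restr_fun h k)%R.
Proof. exact: cocycle_eq. Qed.

Fact restr_g1 g : restr_fun g 1 = 1%R.
Proof. exact: cocycle_g1. Qed.

Fact restr_1g g : restr_fun 1 g = 1%R.
Proof. exact: cocycle_1g. Qed.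

Definition cocycle_restr : two_cocycle R (subgrp H) :=
  TwoCocycle restr_norm restr_eq restr_g1 restr_1g.

End Restriction.

Definition sigma_regular_elt (H : {pred G}) (g : G) : Prop :=
  forall h : G, h \in H -> commute g h -> sigma g h = sigma h g.

Definition sigma_regular (H : groupClosed G) : Prop :=
  forall h : G, h \in H ->
    sigma_regular_elt H h -> sigma_regular_elt predT h.

Definition twisted_centralizer (H : groupClosed G) : {pred G} :=
  [pred g : G | `[< forall h : G, h \in H ->
                      commute g h /\ sigma g h = sigma h g >]].

Section TwistedCentralizer.
Variable H : groupClosed G.

Lemma cocycle_neq0 g h : sigma g h != 0%R.
Proof. by rewrite -normr_eq0 cocycle_norm oner_eq0. Qed.

Lemma twisted_centralizer1 : 1 \in twisted_centralizer H.
Proof.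
apply/asboolP => h _.
by rewrite /commute mul1g mulg1 cocycle_1g cocycle_g1.
Qed.

(* sigma(gk,h) sigma(g,k) = sigma(g,kh) sigma(k,h) = sigma(g,hk) sigma(h,k)
   = sigma(gh,k) sigma(g,h) = sigma(hg,k) sigma(h,g)
   = sigma(h,gk) sigma(g,k) *)
Lemma twisted_centralizerM : mulg_closed (twisted_centralizer H).
Proof.
move=> g k /asboolP Cg /asboolP Ck; apply/asboolP => h hH.
have [gh sgh] := Cg h hH; have [kh skh] := Ck h hH.
split; first by rewrite /commute -mulgA kh mulgA gh mulgA.
apply: (mulfI (cocycle_neq0 g k)).
rewrite cocycle_eq kh skh -cocycle_eq gh sgh cocycle_eq.
by rewrite mulrC.
Qed.

Lemma twisted_centralizerV : invg_closed (twisted_centralizer H).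
Proof.
move=> g /asboolP Cg; apply/asboolP => h hH.
have [gh sgh] := Cg h hH.
have gVh : g^-1 * h = h * g^-1.
  by apply: (mulgI g); rewrite mulgA mulgV mul1g mulgA gh mulgK.
split=> //.
have e1 := cocycle_eq sigma g g^-1 h.
have e2 := cocycle_eq sigma g h g^-1.
have e3 := cocycle_eq sigma h g g^-1.
rewrite mulgV cocycle_1g mulr1 in e1.
rewrite mulgV cocycle_g1 mul1r -gh -sgh in e3.
apply: (mulfI (cocycle_neq0 g (g^-1 * h))).
by rewrite -e1 gVh -e2 e3.
Qed.

HB.instance Definition _ :=
  isMulClosed.Build G (twisted_centralizer H) twisted_centralizerM.
HB.instance Definition _ :=
  isMul1Closed.Build G (twisted_centralizer H) twisted_centralizer1.
HB.instance Definition _ :=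
  isInvClosed.Build G (twisted_centralizer H) twisted_centralizerV.

Definition twisted_centralizer_group : groupClosed G :=
  GroupClosed.clone G (twisted_centralizer H) _.

End TwistedCentralizer.
End Cocycles.

Section Ell2.
Variables (R : realType) (G : groupType).

Definition sqnorm (f : G -> R[i]) : \bar R :=
  (\esum_(g in [set: G]) ((normc (f g)) ^+ 2)%:E)%E.

Definition square_summable : {pred (G -> R[i])} :=
  [pred f | `[< (sqnorm f < +oo)%E >]].

Lemma square_summable_submod : submod_closed square_summable.
Proof.
split=> [|a u v /asboolP uS /asboolP vS]; apply/asboolP; rewrite /sqnorm.
  rewrite esum1 ?ltry// => g _.
  by rewrite -[(0 : G -> R[i]) g]/(0 : R[i]) normc0 expr0n.
have sq0 (w : G -> R[i]) (g : G) : (0 <= ((normc (w g)) ^+ 2)%:E :> \bar R)%E.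
  by rewrite lee_fin sqr_ge0.
have cst (c : R) (w : G -> R[i]) : 0 <= c -> (sqnorm w < +oo)%E ->
    (\esum_(g in [set: G]) (c * (normc (w g)) ^+ 2)%:E < +oo)%E.
  move=> c0 wS; have [r r0 Er] : exists2 r : R, 0 <= r & sqnorm w = r%:E.
    have w0 : (0 <= sqnorm w)%E by apply: esum_ge0 => g _; exact: sq0.
    exists (fine (sqnorm w)); first exact: fine_ge0.
    by rewrite fineK// ge0_fin_numE.
  apply: (@le_lt_trans _ _ (c * r)%:E); last exact: ltry.
  apply: ge_ereal_sup => _ [X [finX _] <-].
  have [Er' _] : (sqnorm w <= r%:E)%E /\ True by rewrite Er.
  rewrite EFinM (_ : (\sum_(x \in X) _)%E =
    (c%:E * \sum_(x \in X) ((normc (w x)) ^+ 2)%:E)%E); last first.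
    rewrite !fsbig_finite//= ge0_sume_distrr//.
  rewrite lee_wpmul2l ?lee_fin//; apply: le_trans Er'.
  by apply: ereal_sup_ubound; exists X.
have c2 : 0 <= 2 * (normc a) ^+ 2 :> R by rewrite mulr_ge0 ?sqr_ge0.
have two0 : 0 <= 2 :> R by [].
apply: (@le_lt_trans _ _
  (\esum_(g in [set: G]) ((2 * (normc a) ^+ 2 * (normc (u g)) ^+ 2)%:E
     + (2 * (normc (v g)) ^+ 2)%:E))%E).
  apply: le_esum => g _; rewrite -EFinD lee_fin.
  rewrite -[(_ + _) g]/(a * u g + v g).
  have nge0 (z : R[i]) : 0 <= normc z by case: z => x y; exact: sqrtr_ge0.
  have h1 := le_normcD (a * u g) (v g); rewrite normcM in h1.
  apply: (@le_trans _ _ ((normc a * normc (u g) + normc (v g)) ^+ 2)).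
    by rewrite lerXn2r ?nnegrE ?addr_ge0 ?mulr_ge0.
  rewrite -mulrA -exprMn; move: (normc a * _) (normc (v g)) => x y.
  rewrite -mulrDr -subr_ge0 (_ : _ - _ = (x - y) ^+ 2) ?sqr_ge0//.
  by rewrite sqrrD sqrrB mulrDr !mulr2n !mulrDl !mul1r; ring.
rewrite esumD; first 1 last.
- by move=> g _; rewrite lee_fin mulr_ge0 ?sqr_ge0.
- by move=> g _; rewrite lee_fin mulr_ge0 ?sqr_ge0.
by rewrite lte_add_pinfty// cst.
Qed.

HB.instance Definition _ :=
  GRing.isSubmodClosed.Build R[i] (G -> R[i]) square_summable
    square_summable_submod.

Record ell2 := Ell2 {
  ell2_fun :> G -> R[i];
  ell2_funP : ell2_fun \in square_summable
}.

HB.instance Definition _ := [isSub for ell2_fun].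
HB.instance Definition _ := [Choice of ell2 by <:].
HB.instance Definition _ := [SubChoice_isSubLmodule of ell2 by <:].

Definition ell2_norm (x : ell2) : R := Num.sqrt (fine (sqnorm x)).

(* The unordered sum of an absolutely summable real family. *)
Definition real_sum (f : G -> R) : R :=
  fine (\esum_(g in [set: G]) (Num.max (f g) 0)%:E)%E
  - fine (\esum_(g in [set: G]) (Num.max (- f g) 0)%:E)%E.

Definition ell2_inner (x y : ell2) : R[i] :=
  Complex (real_sum (fun g => complex.Re (x g * (y g)^*%C)))
          (real_sum (fun g => complex.Im (x g * (y g)^*%C))).

Definition operator := ell2 -> ell2.

Definition bounded_op (T : operator) : Prop :=
  linear T /\ exists M : R, forall x, ell2_norm (T x) <= M * ell2_norm x.

(* Only meaningful on bounded operators: [sup] is 0 on unbounded sets. *)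
Definition op_norm (T : operator) : R :=
  sup [set ell2_norm (T x) | x in [set x | ell2_norm x <= 1]].

(* The adjoint is a relation: [S = T^*]. *)
Definition adjoint_of (T S : operator) : Prop :=
  forall x y, ell2_inner (T x) y = ell2_inner x (S y).

Definition norm_closed (A : set operator) : Prop :=
  forall T, bounded_op T ->
    (forall e : R, 0 < e -> exists2 S, A S & op_norm (T \- S) < e) -> A T.

Record Cstar_subalgebra (A : set operator) : Prop := {
  Cstar_bounded : A `<=` bounded_op;
  Cstar_0 : A (fun=> 0);
  Cstar_add : forall S T, A S -> A T -> A (S \+ T);
  Cstar_scale : forall (c : R[i]) T, A T -> A (fun x => c *: T x);
  Cstar_mul : forall S T, A S -> A T -> A (S \o T);
  Cstar_adjoint : forall S T, A S -> bounded_op T -> adjoint_of S T -> A T;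
  Cstar_closed : norm_closed A
}.

Record closed_ideal (A I : set operator) : Prop := {
  ideal_sub : I `<=` A;
  ideal_0 : I (fun=> 0);
  ideal_add : forall S T, I S -> I T -> I (S \+ T);
  ideal_scale : forall (c : R[i]) T, I T -> I (fun x => c *: T x);
  ideal_mull : forall S T, A S -> I T -> I (S \o T);
  ideal_mulr : forall S T, I S -> A T -> I (S \o T);
  ideal_closed : norm_closed I
}.

Definition simple_algebra (A : set operator) : Prop :=
  A <> [set (fun=> 0)] /\
  forall I, closed_ideal A I -> I = [set (fun=> 0)] \/ I = A.

End Ell2.

Section Reduced.
Variables (R : realType) (G : groupType) (sigma : two_cocycle R G).

Definition lambda_fun (g : G) (x : G -> R[i]) (h : G) : R[i] :=
  sigma g (g^-1 * h)%g * x (g^-1 * h)%g.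

Lemma lambda_summable (g : G) (x : ell2 R G) :
  lambda_fun g x \in @square_summable R G.
Proof.
apply/asboolP; have /asboolP := ell2_funP x.
suff -> : sqnorm x = sqnorm (lambda_fun g x) by [].
have bij : set_bij [set: G] [set: G] (fun h => (g^-1 * h)%g).
  split=> //; first by move=> h k _ _ /mulgI.
  by move=> h _; exists (g * h)%g => //; rewrite mulKg.
rewrite /sqnorm (reindex_esum _ _ _ _ bij); apply: eq_esum => h _.
rewrite /lambda_fun normcM.
suff -> : normc (sigma g (g^-1 * h)%g) = 1 by rewrite mul1r.
have := cocycle_norm sigma g (g^-1 * h)%g.
by rewrite normc_def => -[]; case: (sigma _ _).
Qed.

Definition lambda (g : G) : operator R G :=
  fun x => Ell2 (lambda_summable g x).

Definition reduced_algebra : set (operator R G) :=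
  smallest (@Cstar_subalgebra R G) (range lambda).

Definition Cstar_simple : Prop := simple_algebra reduced_algebra.

End Reduced.

(* Main.v *)
Require Import Defs.
From HB Require Import structures.
From mathcomp Require Import all_boot all_order all_algebra.
From mathcomp Require Import complex.
From mathcomp Require Import boolp classical_sets functions cardinality fsbigop.
From mathcomp Require Import reals ereal esum.
From mathcomp Require Import ring lra zify.

Set Implicit Arguments.
Unset Strict Implicit.
Unset Printing Implicit Defensive.

Import Order.TTheory GRing.Theory Num.Theory ComplexField Normc.

Local Open Scope classical_set_scope.
Local Open Scope ring_scope.

(* Both implications reduce to the equivalence, for FC-hypercentral groups, of
   C*-simplicity with Kleppner's condition: every [x <> 1] with a finite
   conjugacy class commutes with some [h] such that
   sigma(x, h) <> sigma(h, x).

   Kleppner implies simple.  Suitable averages of the maps Ad(lambda(g)) make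
   any lambda(x), [x <> 1], arbitrarily small in norm; this is shown by
   transfinite induction along the upper FC-series.  If it holds on a normal
   subgroup [N] and [x] has a finite class modulo [N], first make
   lambda(x) small in the l^2 norm (a vector of almost minimal norm in the
   convex hull of its orbit is almost invariant, so its coefficients are
   uniformly small), then split the result along the cosets of [N]: for a piece
   [b], the element b^* b - |b|_2^2 is supported on [N] minus 1, so it averages
   to zero, and |Phi(b)|^2 <= |Phi(b^* b)|.  Hence an element T of a nonzero
   ideal averages to a nonzero scalar.

   Simple implies Kleppner.  A finite class violating the condition gives a
   central element z that is not scalar; simplicity forces z^* z to be scalar,
   also for z + 1 and z + i.

   Group theory.  In a prime group a nontrivial element with a finite class has
   infinite order, by Dietzmann's lemma.  If z in [H] is a product of
   finite-class regular elements, then a power of z is regular.  For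
   (i) => (ii) apply this to z = x^-1 x^h with [x] a finite-class regular
   element of [G]: Kleppner for [H] gives z = 1, so [x] is in C_G^sigma(H).  For (ii) => (i) apply it to an element z <> 1 of the FC-center
   of [G] in the normal subgroup generated by the finite-class regular elements
   of [H] (or of C_G^sigma(H)). *)

(** * Unconditional sums and l^2 *)

Section RealSum.
Variables (R : realType) (G : groupType).
Implicit Types f p q : G -> R.

Definition tsum (f : G -> R) : \bar R := (\esum_(g in [set: G]) (f g)%:E)%E.

Definition abs_summable (f : G -> R) : Prop :=
  (tsum (fun g => `|f g|%R) < +oo)%E.

Lemma tsum_ge0 f : (forall g, 0 <= f g) -> (0 <= tsum f)%E.
Proof. by move=> f0; apply: esum_ge0 => g _; rewrite lee_fin. Qed.

Lemma tsumE f : (forall g, 0 <= f g) -> (tsum f < +oo)%E ->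
  tsum f = (fine (tsum f))%:E.
Proof. by move=> f0 fS; rewrite fineK// ge0_fin_numE// tsum_ge0. Qed.

Lemma le_tsum f p : (forall g, f g <= p g) -> (tsum f <= tsum p)%E.
Proof. by move=> fp; apply: le_esum => g _; rewrite lee_fin. Qed.

Lemma tsumD f p : (forall g, 0 <= f g) -> (forall g, 0 <= p g) ->
  tsum (fun g => f g + p g) = (tsum f + tsum p)%E.
Proof.
by move=> f0 p0; rewrite /tsum -esumD// => g _; rewrite lee_fin.
Qed.

Lemma le_tsumZ (c : R) f : 0 <= c -> (forall g, 0 <= f g) ->
  (tsum (fun g => (c * f g)%R) <= c%:E * tsum f)%E.
Proof.
move=> c0 f0; apply: ge_ereal_sup => _ [X [finX _] <-].
rewrite (_ : (\sum_(x \in X) _)%E = (c%:E * \sum_(x \in X) (f x)%:E)%E).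
  rewrite lee_wpmul2l ?lee_fin//; apply: ereal_sup_ubound; exists X => //.
under eq_fsbigr do rewrite EFinM.
by rewrite !fsbig_finite//= ge0_sume_distrr// => g _; rewrite lee_fin.
Qed.

Lemma abs_summable_le f p : (forall g, `|f g| <= p g) -> (tsum p < +oo)%E ->
  abs_summable f.
Proof. by move=> fp; apply: le_lt_trans; exact: le_tsum. Qed.

Lemma abs_summableZ (c : R) f : abs_summable f ->
  abs_summable (fun g => c * f g).
Proof.
move=> fS; apply: (@abs_summable_le _ (fun g => `|c| * `|f g|)).
  by move=> g; rewrite normrM.
apply: le_lt_trans (le_tsumZ _ _) _ => //.
by rewrite tsumE//; exact: ltry.
Qed.

Lemma tsum_max f : abs_summable f -> (tsum (fun g => Num.max (f g) 0)%R < +oo)%E.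
Proof.
apply: le_lt_trans; apply: le_tsum => g.
by rewrite ge_max normr_ge0 ler_norm.
Qed.

(** With [f = p - q] the identity f^+ + q = f^- + p holds pointwise, so the value does not depend on
    the splitting. Positive and negative parts are not additive; linearity of [real_sum] is proved
    through this freedom of choice. *)
Lemma real_sumB p q : (forall g, 0 <= p g) -> (forall g, 0 <= q g) ->
  (tsum p < +oo)%E -> (tsum q < +oo)%E ->
  real_sum (fun g => p g - q g) = fine (tsum p) - fine (tsum q).
Proof.
move=> p0 q0 pS qS; rewrite /real_sum.
set f := fun g => p g - q g.
rewrite -/(tsum (fun g => Num.max (f g) 0)).
rewrite -/(tsum (fun g => Num.max (- f g) 0)).
have fS : abs_summable f.
  apply: (@abs_summable_le _ (fun g => p g + q g)).
    by move=> g; rewrite ler_norml /f; have := p0 g; have := q0 g; lra.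
  by rewrite tsumD// lte_add_pinfty.
have nfS : abs_summable (fun g => - f g).
  by apply: abs_summable_le fS => g; rewrite normrN.
have m0 (h : G -> R) g : 0 <= Num.max (h g) 0 by rewrite le_max lexx orbT.
have : (tsum (fun g => Num.max (f g) 0)%R + tsum q =
        tsum (fun g => Num.max (- f g) 0)%R + tsum p)%E.
  rewrite -!tsumD//; try by move=> g; apply: (m0 (fun g => - f g)).
  apply: eq_esum => g _; congr _%:E; rewrite /f.
  by case: (leP (p g - q g) 0); case: (leP (- (p g - q g)) 0); lra.
rewrite (tsumE (m0 f)) ?tsum_max// (tsumE (m0 (fun g => - f g))) ?tsum_max//.
rewrite (tsumE p0)// (tsumE q0)// => -[h]; apply/eqP.
by rewrite subr_eq addrAC eq_sym subr_eq h addrC.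
Qed.

Lemma real_sum_parts f : abs_summable f ->
  exists p q, [/\ forall g, 0 <= p g, forall g, 0 <= q g,
    (tsum p < +oo)%E, (tsum q < +oo)%E & f = fun g => p g - q g].
Proof.
move=> fS; exists (fun g => Num.max (f g) 0), (fun g => Num.max (- f g) 0).
split=> [g|g|||]; rewrite ?le_max ?lexx ?orbT//; first exact: tsum_max.
  by apply: tsum_max; apply: abs_summable_le fS => g; rewrite normrN.
apply/funext => g.
by case: (leP (f g) 0); case: (leP (- f g) 0); lra.
Qed.

Lemma real_sumD f h : abs_summable f -> abs_summable h ->
  real_sum (fun g => f g + h g) = real_sum f + real_sum h.
Proof.
move=> /real_sum_parts[p [q [p0 q0 pS qS ->]]].
move=> /real_sum_parts[p' [q' [p'0 q'0 p'S q'S ->]]].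
rewrite (_ : (fun g => _) = fun g => (p g + p' g) - (q g + q' g)); last first.
  by apply/funext => g; ring.
rewrite !real_sumB ?tsumD ?lte_add_pinfty//; try by move=> g; rewrite addr_ge0.
rewrite (tsumE p0)// (tsumE q0)// (tsumE p'0)// (tsumE q'0)//=; ring.
Qed.

Lemma real_sumN f : real_sum (fun g => - f g) = - real_sum f.
Proof.
rewrite /real_sum opprB; congr (_ - fine _).
by apply: eq_esum => g _; rewrite opprK.
Qed.

Lemma fine_tsumZ (c : R) p : 0 <= c -> (forall g, 0 <= p g) ->
  (tsum p < +oo)%E -> fine (tsum (fun g => c * p g)) = c * fine (tsum p).
Proof.
move=> c0 p0 pS; have [->|cn0] := eqVneq c 0.
  by rewrite mul0r /tsum esum1// => g _; rewrite mul0r.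
have cp0 : 0 < c by rewrite lt_def cn0.
have cpg g : 0 <= c * p g by rewrite mulr_ge0.
have h1 := le_tsumZ c0 p0.
have cpS : (tsum (fun g => (c * p g)%R) < +oo)%E.
  by apply: le_lt_trans h1 _; rewrite tsumE// -EFinM ltry.
(* The reverse inequality is [le_tsumZ] again, now for the factor [c^-1]. *)
have h2 : (tsum p <= (c^-1)%:E * tsum (fun g => (c * p g)%R))%E.
  rewrite [leLHS](_ : _ = tsum (fun g => c^-1 * (c * p g))).
    by apply: le_tsumZ => //; rewrite invr_ge0.
  by apply: eq_esum => g _; rewrite mulKf.
move: h1 h2; rewrite (tsumE p0)// (tsumE cpg)// -!EFinM !lee_fin /=.
by move=> h1; rewrite mulrC ler_pdivlMr// mulrC => h2; apply: le_anti; rewrite h1.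
Qed.

Lemma real_sumZ (c : R) f : abs_summable f ->
  real_sum (fun g => c * f g) = c * real_sum f.
Proof.
move=> fS; wlog c0 : c / 0 <= c.
  move=> H; have [/H//|c0] := leP 0 c.
  rewrite (_ : (fun g => _) = fun g => - ((- c) * f g)); last first.
    by apply/funext => g; ring.
  by rewrite real_sumN H ?oppr_ge0 ?ltW//; ring.
move: fS => /real_sum_parts[p [q [p0 q0 pS qS ->]]].
rewrite (_ : (fun g => _) = fun g => c * p g - c * q g); last first.
  by apply/funext => g; ring.
have cS h : (forall g, 0 <= h g) -> (tsum h < +oo)%E ->
    (tsum (fun g => (c * h g)%R) < +oo)%E.
  move=> h0 hS; apply: le_lt_trans (le_tsumZ c0 h0) _.
  by rewrite tsumE// -EFinM ltry.
rewrite !real_sumB ?cS//; try by move=> g; rewrite mulr_ge0.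
by rewrite !fine_tsumZ//; ring.
Qed.

Lemma real_sum_ge0E f : (forall g, 0 <= f g) -> (tsum f < +oo)%E ->
  real_sum f = fine (tsum f).
Proof.
move=> f0 fS; have z0 : (tsum (fun=> 0%R) = 0)%E by apply: esum1.
rewrite [in LHS](_ : f = fun g => f g - 0) ?real_sumB// ?z0 ?subr0 ?ltry//.
by apply/funext => g; rewrite subr0.
Qed.

Lemma tsum_reindex (e : G -> G) f : bijective e ->
  tsum (fun g => f (e g)) = tsum f.
Proof.
move=> [e' eK e'K]; rewrite /tsum [RHS](reindex_esum setT setT e)//.
split=> [x _|x y _ _|y _]//; first exact: (can_inj eK).
by exists (e' y).
Qed.

Lemma real_sum_reindex (e : G -> G) f : bijective e ->
  real_sum (fun g => f (e g)) = real_sum f.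
Proof.
move=> be; rewrite /real_sum.
congr (fine _ - fine _); first exact: (tsum_reindex (fun g => Num.max (f g) 0)).
exact: (tsum_reindex (fun g => Num.max (- f g) 0)).
Qed.

Lemma tsum_ge f g : (forall h, 0 <= f h) -> ((f g)%:E <= tsum f)%E.
Proof.
move=> f0; rewrite /tsum esum_ge//; exists [set g]; first by split.
by rewrite fsbig_set1.
Qed.

Lemma tsum1 g (c : R) : 0 <= c ->
  tsum (fun h : G => if h == g then c else 0) = c%:E.
Proof.
move=> c0; rewrite /tsum (esumID [set g])//; last first.
  by move=> h _; case: ifP.
rewrite setTI esum_set1 ?eqxx// setTI esum1 ?adde0//.
by move=> h /=; case: eqP.
Qed.

Lemma real_sum1 g (c : R) :
  real_sum (fun h : G => if h == g then c else 0) = c.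
Proof.
wlog c0 : c / 0 <= c.
  move=> H; have [/H//|c0] := leP 0 c.
  rewrite (_ : (fun h => _) = fun h => - (if h == g then - c else 0)).
    by rewrite real_sumN H ?opprK// oppr_ge0 ltW.
  by apply/funext => h; case: eqP => _; rewrite ?opprK ?oppr0.
rewrite real_sum_ge0E ?tsum1 ?ltry//.
by move=> h; case: ifP.
Qed.

End RealSum.

Arguments ell2_fun : simpl never.

(** * The Hilbert space structure of l^2 *)

Section Ell2Theory.
Variables (R : realType) (G : groupType).
Implicit Types (x y z : ell2 R G) (c : R[i]) (g h : G).

Lemma ell2P x y : (forall g, x g = y g) -> x = y.
Proof. by move=> xy; apply: val_inj; apply/funext. Qed.

Lemma ell2D x y g : (x + y) g = x g + y g. Proof. by []. Qed.
Lemma ell2Z c x g : (c *: x) g = c * x g. Proof. by []. Qed.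
Lemma ell20 g : (0 : ell2 R G) g = 0. Proof. by []. Qed.
Lemma ell2N x g : (- x) g = - x g.
Proof. by rewrite -scaleN1r ell2Z mulN1r. Qed.

Lemma ell2_sum (I : Type) (s : seq I) (F : I -> ell2 R G) g :
  (\sum_(i <- s) F i) g = \sum_(i <- s) F i g.
Proof. by elim/big_rec2: _ => // i y1 y2 _ <-. Qed.

Lemma normc_ge0 c : 0 <= normc c.
Proof. by case: c => a b; exact: sqrtr_ge0. Qed.
Hint Resolve normc_ge0 : core.

Lemma sqr_normc_parts c : normc c ^+ 2 = complex.Re c ^+ 2 + complex.Im c ^+ 2.
Proof. by case: c => a b /=; rewrite sqr_sqrtr// addr_ge0 ?sqr_ge0. Qed.

Lemma Re_le_normc c : `|complex.Re c| <= normc c.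
Proof.
rewrite -ler_sqr ?nnegrE ?normr_ge0//.
by rewrite real_normK ?num_real// sqr_normc_parts lerDl sqr_ge0.
Qed.

Lemma Im_le_normc c : `|complex.Im c| <= normc c.
Proof.
rewrite -ler_sqr ?nnegrE ?normr_ge0//.
by rewrite real_normK ?num_real// sqr_normc_parts lerDr sqr_ge0.
Qed.

Lemma normc_conjc c : normc (conjc c) = normc c.
Proof. by case: c => a b /=; rewrite sqrrN. Qed.

Lemma ell2_summable x : (tsum (fun g => (normc (x g)) ^+ 2)%R < +oo)%E.
Proof. by have /asboolP := ell2_funP x. Qed.

Lemma ell2_norm_ge0 x : 0 <= ell2_norm x.
Proof. exact: sqrtr_ge0. Qed.
Hint Resolve ell2_norm_ge0 : core.

Lemma sqr_ell2_norm x :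
  ell2_norm x ^+ 2 = fine (tsum (fun g => (normc (x g)) ^+ 2)).
Proof.
rewrite sqr_sqrtr// fine_ge0//; apply: tsum_ge0 => g; exact: sqr_ge0.
Qed.

Lemma tsumJ_norm x :
  tsum (fun g => (normc (x g)) ^+ 2) = (ell2_norm x ^+ 2)%:E.
Proof.
rewrite sqr_ell2_norm -tsumE ?ell2_summable// => g; exact: sqr_ge0.
Qed.

(** [F] stands for the real or the imaginary part; the bound is ab <= a^2 + b^2. *)
Lemma abs_summable_mul (F : R[i] -> R) x y : (forall c, `|F c| <= normc c) ->
  abs_summable (fun g => F (x g * (y g)^*%C)).
Proof.
move=> FC.
apply: (@abs_summable_le _ _ _ (fun g => normc (x g) ^+ 2 + normc (y g) ^+ 2)).
  move=> g; apply: le_trans (FC _) _; rewrite normcM normc_conjc.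
  move: (normc (x g)) (normc (y g)) (normc_ge0 (x g)) (normc_ge0 (y g)).
  by clear => a b a0 b0; have := sqr_ge0 (a - b); nra.
by rewrite tsumD ?lte_add_pinfty ?ell2_summable// => g; exact: sqr_ge0.
Qed.

Let sRe x y : abs_summable (fun g => complex.Re (x g * (y g)^*%C)).
Proof. by apply: abs_summable_mul; exact: Re_le_normc. Qed.
Let sIm x y : abs_summable (fun g => complex.Im (x g * (y g)^*%C)).
Proof. by apply: abs_summable_mul; exact: Im_le_normc. Qed.

Lemma innerDl x y z : ell2_inner (x + y) z = ell2_inner x z + ell2_inner y z.
Proof.
rewrite /ell2_inner [RHS]/(_ + _)/=; congr Complex.
  rewrite -real_sumD//; congr real_sum; apply/funext => g.
  by rewrite ell2D mulrDl; case: (x g * _) (y g * _) => ? ? [].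
rewrite -real_sumD//; congr real_sum; apply/funext => g.
by rewrite ell2D mulrDl; case: (x g * _) (y g * _) => ? ? [].
Qed.

Lemma ReMc c c' : complex.Re (c * c') =
  complex.Re c * complex.Re c' - complex.Im c * complex.Im c'.
Proof. by case: c c' => ? ? []. Qed.

Lemma ImMc c c' : complex.Im (c * c') =
  complex.Re c * complex.Im c' + complex.Im c * complex.Re c'.
Proof. by case: c c' => ? ? []. Qed.

Lemma innerZl c x y : ell2_inner (c *: x) y = c * ell2_inner x y.
Proof.
apply/eqP; rewrite eq_complex ReMc ImMc; move: (sRe x y) (sIm x y).
rewrite /ell2_inner => hRe hIm; apply/andP; split; apply/eqP.
  rewrite -mulNr -real_sumZ// -real_sumZ// -real_sumD.
  - by congr real_sum; apply/funext => g; rewrite ell2Z -mulrA ReMc mulNr.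
  - exact: abs_summableZ.
  - exact: abs_summableZ.
rewrite -real_sumZ// -real_sumZ// -real_sumD.
- by congr real_sum; apply/funext => g; rewrite ell2Z -mulrA ImMc.
- exact: abs_summableZ.
- exact: abs_summableZ.
Qed.

Lemma innerC x y : ell2_inner y x = (ell2_inner x y)^*%C.
Proof.
rewrite /ell2_inner /=; congr Complex.
  congr real_sum; apply/funext => g.
  by case: (x g) (y g) => a b [a' b'] /=; ring.
rewrite -real_sumN; congr real_sum; apply/funext => g.
by case: (x g) (y g) => a b [a' b'] /=; ring.
Qed.

Lemma conjcD c c' : conjc (c + c') = conjc c + conjc c'.
Proof. exact: rmorphD. Qed.

Lemma conjcM c c' : conjc (c * c') = conjc c * conjc c'.
Proof. exact: rmorphM. Qed.

Lemma innerDr x y z : ell2_inner x (y + z) = ell2_inner x y + ell2_inner x z.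
Proof. by rewrite innerC innerDl conjcD -(innerC y) -(innerC z). Qed.

Lemma innerZr c x y : ell2_inner x (c *: y) = conjc c * ell2_inner x y.
Proof. by rewrite innerC innerZl conjcM -(innerC y). Qed.

Lemma innerBl x y z : ell2_inner (x - y) z = ell2_inner x z - ell2_inner y z.
Proof. by rewrite innerDl -(scaleN1r y) innerZl mulN1r. Qed.

Lemma innerBr x y z : ell2_inner x (y - z) = ell2_inner x y - ell2_inner x z.
Proof.
by rewrite innerDr -(scaleN1r z) innerZr -[in RHS]mulN1r; congr (_ + _ * _); rewrite /= oppr0.
Qed.

Lemma inner_self x : complex.Re (ell2_inner x x) = ell2_norm x ^+ 2.
Proof.
rewrite sqr_ell2_norm /= -real_sum_ge0E ?ell2_summable//; last first.
  by move=> g; exact: sqr_ge0.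
congr real_sum; apply/funext => g.
by rewrite sqr_normc_parts; case: (x g) => a b /=; ring.
Qed.

Lemma ReDc c c' : complex.Re (c + c') = complex.Re c + complex.Re c'.
Proof. by case: c c' => ? ? []. Qed.

Lemma ell2_normB_sq x y : ell2_norm (x + y) ^+ 2 =
  ell2_norm x ^+ 2 + 2 * complex.Re (ell2_inner x y) + ell2_norm y ^+ 2.
Proof.
rewrite -!inner_self innerDl !innerDr !ReDc (innerC x y).
have -> (c : R[i]) : complex.Re (conjc c) = complex.Re c by case: c.
by ring.
Qed.

Lemma ell2_normZ c x : ell2_norm (c *: x) = normc c * ell2_norm x.
Proof.
apply/eqP; rewrite -(@eqrXn2 _ 2)// ?mulr_ge0// exprMn -!inner_self.
rewrite innerZl innerZr mulrA.
case: c => a b; case: (ell2_inner x x) => e f /=.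
by rewrite sqr_sqrtr ?addr_ge0 ?sqr_ge0//; apply/eqP; ring.
Qed.

Lemma ell2_normN x : ell2_norm (- x) = ell2_norm x.
Proof. by rewrite -scaleN1r ell2_normZ normcN normc1 mul1r. Qed.

Lemma ell2_norm0 : ell2_norm (0 : ell2 R G) = 0.
Proof. by rewrite -(scale0r 0) ell2_normZ normc0 mul0r. Qed.

Lemma cauchy_schwarz x y :
  complex.Re (ell2_inner x y) <= ell2_norm x * ell2_norm y.
Proof.
have H (t : R) : 0 <= ell2_norm x ^+ 2 - 2 * t * complex.Re (ell2_inner x y)
    + t ^+ 2 * ell2_norm y ^+ 2.
  have := sqr_ge0 (ell2_norm (x + (- t)%:C%C *: y)).
  rewrite ell2_normB_sq ell2_normZ innerZr exprMn sqr_normc_parts.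
  case: (ell2_inner x y) => p q /= h; apply: (le_trans h).
  by rewrite le_eqVlt; apply/orP; left; apply/eqP; ring.
move: (complex.Re _) (ell2_norm x) (ell2_norm y) (ell2_norm_ge0 x)
  (ell2_norm_ge0 y) H; clear => p a b a0 b0 H.
have [b00|bn0] := eqVneq b 0.
  rewrite b00 mulr0 leNgt; apply/negP => p0.
  (* This value of [t] would make the quadratic expression equal to -1. *)
  have := H ((a ^+ 2 + 1) / (2 * p)); rewrite b00 expr0n mulr0 addr0.
  rewrite (_ : 2 * _ * p = a ^+ 2 + 1); first by lra.
  by field; rewrite gt_eqF.
have bp : 0 < b by rewrite lt_def bn0.
(* The quadratic polynomial in [t] attains its minimum at [p / b^2]. *)
have := H (p / b ^+ 2); rewrite (_ : _ + _ = a ^+ 2 - (p / b) ^+ 2); last by field.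
rewrite subr_ge0 => h; rewrite leNgt; apply/negP; rewrite -ltr_pdivlMr// => ab.
by move: h; rewrite leNgt ltr_sqr ?nnegrE ?ab// (le_trans a0)// ltW.
Qed.

Lemma ell2_norm_triangle x y :
  ell2_norm (x + y) <= ell2_norm x + ell2_norm y.
Proof.
rewrite -ler_sqr ?nnegrE ?addr_ge0// ell2_normB_sq sqrrD.
by have := cauchy_schwarz x y; lra.
Qed.

Lemma ell2_norm_sum (I : Type) (s : seq I) (F : I -> ell2 R G) :
  ell2_norm (\sum_(i <- s) F i) <= \sum_(i <- s) ell2_norm (F i).
Proof.
elim/big_rec2: _ => [|i a y _ h]; first by rewrite ell2_norm0.
by apply: le_trans (ell2_norm_triangle _ _) _; rewrite lerD2l.
Qed.

Lemma normc_le_ell2 x g : normc (x g) <= ell2_norm x.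
Proof.
rewrite -ler_sqr ?nnegrE// -lee_fin -tsumJ_norm.
by apply: (tsum_ge (f := fun g => normc (x g) ^+ 2)) => h; exact: sqr_ge0.
Qed.

Lemma ell2_norm_eq0 x : ell2_norm x = 0 -> x = 0.
Proof.
move=> x0; apply: ell2P => g; apply: eq0_normc; apply/eqP.
by rewrite eq_le normc_ge0 andbT -x0 normc_le_ell2.
Qed.

Lemma ell2_norm_le x y : (forall g, normc (x g) <= normc (y g)) ->
  ell2_norm x <= ell2_norm y.
Proof.
move=> xy; rewrite -ler_sqr ?nnegrE// -lee_fin -!tsumJ_norm.
by apply: le_tsum => g; rewrite ler_sqr ?nnegrE.
Qed.

Lemma ell2_norm_reindex (e : G -> G) x y : bijective e ->
  (forall g, normc (x g) = normc (y (e g))) -> ell2_norm x = ell2_norm y.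
Proof.
move=> be xy; apply/eqP; rewrite -(@eqrXn2 _ 2)// !sqr_ell2_norm.
apply/eqP; rewrite -[in RHS](tsum_reindex _ be); congr (fine (tsum _)).
by apply/funext => g; rewrite xy.
Qed.

Lemma inner_reindex (e : G -> G) x y x' y' : bijective e ->
  (forall g, x g * (y g)^*%C = x' (e g) * (y' (e g))^*%C) ->
  ell2_inner x y = ell2_inner x' y'.
Proof.
move=> be xy; rewrite /ell2_inner; congr Complex.
  rewrite -[RHS](real_sum_reindex _ be); congr real_sum.
  by apply/funext => g; rewrite xy.
rewrite -[RHS](real_sum_reindex _ be); congr real_sum.
by apply/funext => g; rewrite xy.
Qed.

Lemma delta_summable g :
  (fun h => if h == g then 1 else 0) \in @square_summable R G.
Proof.
apply/asboolP; rewrite /sqnorm.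
rewrite (_ : (fun h => _) = fun h => (if h == g then 1 else 0)%:E).
  by rewrite -/(tsum _) tsum1 ?ltry.
apply/funext => h; congr _%:E.
by case: eqP => _; rewrite ?normc1 ?normc0 ?expr1n ?expr0n.
Qed.

Definition delta g : ell2 R G := Ell2 (delta_summable g).

Lemma deltaE g h : delta g h = if h == g then 1 else 0. Proof. by []. Qed.

Lemma inner_delta x g : ell2_inner x (delta g) = x g.
Proof.
rewrite /ell2_inner; set a := x g.
rewrite [RHS](_ : _ = Complex (complex.Re a) (complex.Im a)); last by case: (a).
congr Complex; rewrite -[RHS](real_sum1 g); congr real_sum; apply/funext => h.
  rewrite deltaE; case: eqP => [->|_]; last by rewrite conjc0 mulr0.
  by rewrite conjc1 mulr1.
rewrite deltaE; case: eqP => [->|_]; last by rewrite conjc0 mulr0.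
by rewrite conjc1 mulr1.
Qed.

Lemma ell2_norm_delta g : ell2_norm (delta g) = 1.
Proof.
apply/eqP; rewrite -(@eqrXn2 _ 2)// -inner_self inner_delta deltaE eqxx.
by rewrite expr1n.
Qed.

(** The squared norm is a supremum of finite partial sums. A finite set [X] that misses less than
    e^2 of it will do, since by orthogonality the error is the norm of [x] off [X]. *)
Lemma finite_approx x (e : R) : 0 < e ->
  exists s : seq G, ell2_norm (x - \sum_(g <- s) x g *: delta g) <= e.
Proof.
move=> e0; set N := ell2_norm x ^+ 2.
have f0 (z : ell2 R G) g : (0 <= (normc (z g) ^+ 2)%:E)%E by rewrite lee_fin sqr_ge0.
have : ((N - e ^+ 2)%:E < \esum_(g in [set: G]) (normc (x g) ^+ 2)%:E)%E.
  by rewrite -/(tsum _) tsumJ_norm lte_fin gtrBl exprn_gt0.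
move=> /ereal_sup_gt[_ [X [finX _]] <-].
set s := fset_set X => h; exists (finmap.enum_fset s); set y := (_ - _).
have yE g : y g = if g \in X then 0 else x g.
  rewrite /y ell2D ell2N ell2_sum -(in_fset_set finX).
  case: ifP => gX.
    rewrite (bigD1_seq g)//= ?finmap.fset_uniq// ell2Z deltaE eqxx mulr1 big1 ?addr0 ?subrr//.
    by move=> k kg; rewrite ell2Z deltaE eq_sym (negbTE kg) mulr0.
  rewrite big_seq big1 ?subr0// => k ks; rewrite ell2Z deltaE.
  by case: eqP gX ks => [->|]; rewrite ?mulr0// /s => -> .
have yN : (N%:E = (ell2_norm y ^+ 2)%:E + \sum_(g \in X) (normc (x g) ^+ 2)%:E)%E.
  rewrite -!tsumJ_norm /tsum (esumID X setT)// [in RHS](esumID X setT)// !setTI.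
  rewrite esum_fset// addeC [X in _ = (X + _ + _)%E]esum1 ?add0e; last first.
    by move=> g gX /=; rewrite yE mem_set// normc0 expr0n.
  congr (_ + _)%E; apply: eq_esum => g gX /=; rewrite yE ifF//.
  by apply/negP => /set_mem.
rewrite -ler_sqr ?nnegrE ?ell2_norm_ge0 ?(ltW e0)//.
move: h yN; rewrite fsbig_finite//= sumEFin -EFinD lte_fin => h [yN].
by lra.
Qed.

End Ell2Theory.

(** * Twisted translations and their averages *)

Section TwistedOperators.
Variables (R : realType) (G : groupType) (sigma : two_cocycle R G).
Implicit Types (x y z : ell2 R G) (c : R[i]) (g h k : G) (T a b : operator R G).
Implicit Type s t : seq (R[i] * G).

Local Notation lam := (lambda sigma).

Let normc_pos c : 0 <= normc c. Proof. exact: normc_ge0. Qed.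
Let norm_pos x : 0 <= ell2_norm x. Proof. exact: ell2_norm_ge0. Qed.
Hint Resolve normc_pos norm_pos : core.

Lemma normc_cocycle g h : normc (sigma g h) = 1.
Proof. by have := cocycle_norm sigma g h; rewrite normc_def; case: (sigma g h) => p q []. Qed.

Lemma cocycle_invg g : sigma g^-1%g g = sigma g g^-1%g.
Proof.
have := cocycle_eq sigma g g^-1%g g.
by rewrite mulgV mulVg cocycle_1g cocycle_g1 mulr1 mul1r.
Qed.

(* [lambda g lambda k lambda g^-1 = twist g k lambda (g k g^-1)] *)
Definition twist g k : R[i] := sigma g k / sigma (k ^ g^-1)%g g.

Lemma normc_twist g k : normc (twist g k) = 1.
Proof. by rewrite normcM normcV !normc_cocycle invr1 mulr1. Qed.

Lemma lambdaE g x h : lam g x h = sigma g (g^-1 * h)%g * x (g^-1 * h)%g.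
Proof. by []. Qed.

Lemma lambdaD g x y : lam g (x + y) = lam g x + lam g y.
Proof. by apply: ell2P => h; rewrite ell2D !lambdaE ell2D mulrDr. Qed.

Lemma lambdaZ g c x : lam g (c *: x) = c *: lam g x.
Proof. by apply: ell2P => h; rewrite ell2Z !lambdaE ell2Z mulrCA. Qed.

Lemma lambda_mul g h x : lam g (lam h x) = sigma g h *: lam (g * h)%g x.
Proof.
apply: ell2P => k; rewrite ell2Z !lambdaE invgM -!mulgA.
have := cocycle_eq sigma g h (h^-1 * (g^-1 * k))%g.
rewrite mulVKg => e; rewrite mulrA -e; ring.
Qed.

Lemma lambda1 x : lam 1%g x = x.
Proof. by apply: ell2P => k; rewrite lambdaE invg1 mul1g cocycle_1g mul1r. Qed.

Lemma mulgl_bij g : bijective (fun h => g * h)%g.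
Proof. by exists (fun h => g^-1 * h)%g => h; rewrite (mulKg, mulVKg). Qed.

Lemma norm_lambda g x : ell2_norm (lam g x) = ell2_norm x.
Proof.
apply: (ell2_norm_reindex (mulgl_bij g^-1)) => h.
by rewrite lambdaE normcM normc_cocycle mul1r.
Qed.

Lemma mulcJ c : c * conjc c = Complex (normc c ^+ 2) 0.
Proof. by rewrite sqr_normc_parts; case: c => p q; rewrite /GRing.mul/=; congr Complex; ring. Qed.

Lemma inner_lambda g x y : ell2_inner (lam g x) (lam g y) = ell2_inner x y.
Proof.
apply: (inner_reindex (mulgl_bij g^-1)) => h; rewrite !lambdaE conjcM.
rewrite mulrACA mulcJ normc_cocycle expr1n.
by rewrite -[Complex 1 0]/(1 : R[i]) mul1r.
Qed.

(** The adjoint and inverse of [lambda g]; [lambda g^-1] differs from it by the scalar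
    [sigma g g^-1]. *)
Definition lamV g : operator R G := fun x => (sigma g g^-1%g)^-1 *: lam g^-1%g x.

Lemma lamK g x : lamV g (lam g x) = x.
Proof.
rewrite /lamV lambda_mul mulVg lambda1 cocycle_invg scalerA mulVf ?scale1r//.
exact: cocycle_neq0.
Qed.

Lemma lamVK g x : lam g (lamV g x) = x.
Proof.
rewrite /lamV lambdaZ lambda_mul mulgV lambda1 scalerA mulVf ?scale1r//.
exact: cocycle_neq0.
Qed.

Lemma norm_lamV g x : ell2_norm (lamV g x) = ell2_norm x.
Proof. by rewrite -[in RHS](lamVK g x) norm_lambda. Qed.

Lemma inner_lamV g x y : ell2_inner (lam g x) y = ell2_inner x (lamV g y).
Proof. by rewrite -[in LHS](lamVK g y) inner_lambda. Qed.

Definition Ad g T : operator R G := fun x => lam g (T (lamV g x)).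

Lemma Ad_lambda g k : Ad g (lam k) = fun x => twist g k *: lam (k ^ g^-1)%g x.
Proof.
apply/funext => x; rewrite /Ad -{2}(lamVK g x); move: (lamV g x) => y.
rewrite !lambda_mul -conjgCV scalerA /twist divfK//; exact: cocycle_neq0.
Qed.

(** Elements of the twisted group algebra are given by lists of terms, with repetitions allowed.
    Products, adjoints and conjugates are then operations on lists, and [ell1] of a list bounds the
    operator norm. *)
Definition lsum s : operator R G := fun x => \sum_(p <- s) p.1 *: lam p.2 x.

Definition ell1 s : R := \sum_(p <- s) normc p.1.

Lemma lsumE s x : lsum s x = \sum_(p <- s) p.1 *: lam p.2 x. Proof. by []. Qed.

Lemma lsum_cons p s x : lsum (p :: s) x = p.1 *: lam p.2 x + lsum s x.
Proof. by rewrite /lsum big_cons. Qed.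

Lemma lsum_nil x : lsum [::] x = 0. Proof. by rewrite /lsum big_nil. Qed.

Lemma lsum1 c g x : lsum [:: (c, g)] x = c *: lam g x.
Proof. by rewrite /lsum big_seq1. Qed.

Lemma lsum_cat s t x : lsum (s ++ t) x = lsum s x + lsum t x.
Proof. by rewrite /lsum big_cat. Qed.

Definition lscale c s := [seq (c * p.1, p.2) | p <- s].

Lemma lsum_scale c s x : lsum (lscale c s) x = c *: lsum s x.
Proof.
rewrite /lsum big_map scaler_sumr; apply: eq_bigr => p _ /=.
by rewrite scalerA.
Qed.

Lemma ell1_scale c s : ell1 (lscale c s) = normc c * ell1 s.
Proof.
by rewrite /ell1 big_map mulr_sumr; apply: eq_bigr => p _; rewrite normcM.
Qed.

Lemma ell1_cat s t : ell1 (s ++ t) = ell1 s + ell1 t.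
Proof. by rewrite /ell1 big_cat. Qed.

Lemma ell1_ge0 s : 0 <= ell1 s.
Proof. by apply: sumr_ge0 => p _. Qed.

Lemma lsumD s x y : lsum s (x + y) = lsum s x + lsum s y.
Proof.
by rewrite /lsum -big_split; apply: eq_bigr => p _; rewrite lambdaD scalerDr.
Qed.

Lemma lsumZ s c x : lsum s (c *: x) = c *: lsum s x.
Proof.
rewrite /lsum scaler_sumr; apply: eq_bigr => p _.
by rewrite lambdaZ !scalerA mulrC.
Qed.

Lemma lsum_linear s : linear (lsum s).
Proof. by move=> c x y; rewrite lsumD lsumZ. Qed.

Definition conj_seq g s := [seq (p.1 * twist g p.2, (p.2 ^ g^-1)%g) | p <- s].

Lemma lambda0 g : lam g 0 = 0.
Proof. by apply: ell2P => h; rewrite lambdaE ell20 mulr0. Qed.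

Lemma lambda_sum (I : Type) (r : seq I) (F : I -> ell2 R G) g :
  lam g (\sum_(i <- r) F i) = \sum_(i <- r) lam g (F i).
Proof.
elim/big_rec2: _ => [|i y z _ <-]; last by rewrite lambdaD.
by rewrite lambda0.
Qed.

Lemma Ad_lsum g s : Ad g (lsum s) = lsum (conj_seq g s).
Proof.
apply/funext => x; rewrite /Ad /lsum lambda_sum big_map; apply: eq_bigr => p _.
rewrite lambdaZ -[lam g _]/(Ad g (lam p.2) x) Ad_lambda /=.
by rewrite scalerA.
Qed.

Lemma ell1_conj g s : ell1 (conj_seq g s) = ell1 s.
Proof.
rewrite /ell1 big_map; apply: eq_bigr => p _ /=.
by rewrite normcM normc_twist mulr1.
Qed.

Definition bounded_by T (M : R) := forall x, ell2_norm (T x) <= M * ell2_norm x.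

Lemma lsum_bounded s : bounded_by (lsum s) (ell1 s).
Proof.
move=> x; apply: le_trans (ell2_norm_sum _ _) _; rewrite /ell1 mulr_suml.
by apply: ler_sum => p _; rewrite ell2_normZ norm_lambda.
Qed.

Lemma lambda_delta g h : lam g (delta R h) = sigma g h *: delta R (g * h)%g.
Proof.
apply: ell2P => k; rewrite ell2Z lambdaE !deltaE.
have -> : (g^-1 * k == h)%g = (k == (g * h)%g).
  by apply/eqP/eqP => [<-|->]; rewrite (mulKg, mulVKg).
by case: eqP => [->|_]; rewrite ?mulr0// mulKg.
Qed.

(** The Fourier coefficient of [T] at [g]; for [g = 1] it is the canonical trace. *)
Definition coef T g := T (delta R 1%g) g.

Lemma lambda_delta1 g : lam g (delta R 1%g) = delta R g.
Proof. by rewrite lambda_delta mulg1 cocycle_g1 scale1r. Qed.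

Lemma lsum_delta1 s : lsum s (delta R 1%g) = \sum_(p <- s) p.1 *: delta R p.2.
Proof. by apply: eq_bigr => p _; rewrite lambda_delta1. Qed.

Lemma coef_lsum s g : coef (lsum s) g = \sum_(p <- s | p.2 == g) p.1.
Proof.
rewrite /coef lsum_delta1 ell2_sum [RHS]big_mkcond/=; apply: eq_bigr => p _.
by rewrite ell2Z deltaE eq_sym; case: ifP; rewrite ?mulr1 ?mulr0.
Qed.

Lemma lsum_split1 s : lsum s =
  (fun v => coef (lsum s) 1%g *: v + lsum [seq p <- s | p.2 != 1%g] v).
Proof.
apply/funext => v; rewrite coef_lsum !lsumE big_filter.
rewrite (bigID (fun p : R[i] * G => p.2 == 1%g))/= scaler_suml; congr (_ + _).
by apply: eq_bigr => p /eqP ->; rewrite lambda1.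
Qed.

Lemma coef_Ad g s k :
  coef (Ad g (lsum s)) k = twist g (k ^ g)%g * coef (lsum s) (k ^ g)%g.
Proof.
rewrite Ad_lsum !coef_lsum big_map mulr_sumr.
apply: eq_big => [p|p /eqP <-] /=; last by rewrite conjgKV mulrC.
by apply/eqP/eqP => [<-|->]; rewrite ?conjgKV ?conjgK.
Qed.

Lemma conjg_bij g : bijective (fun h => h ^ g)%g.
Proof. by exists (fun h => h ^ g^-1)%g => h; rewrite (conjgK, conjgKV). Qed.

Lemma norm_Ad_delta g s : ell2_norm (Ad g (lsum s) (delta R 1%g)) =
  ell2_norm (lsum s (delta R 1%g)).
Proof.
apply: (ell2_norm_reindex (conjg_bij g)) => k.
by rewrite -/(coef _ _) coef_Ad normcM normc_twist mul1r.
Qed.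

Lemma inner_suml (I : Type) (r : seq I) (F : I -> ell2 R G) y :
  ell2_inner (\sum_(i <- r) F i) y = \sum_(i <- r) ell2_inner (F i) y.
Proof.
elim/big_rec2: _ => [|i z w _ <-]; last by rewrite innerDl.
by rewrite -[X in ell2_inner X _](scale0r y) innerZl mul0r.
Qed.

Lemma inner_sumr (I : Type) (r : seq I) (F : I -> ell2 R G) y :
  ell2_inner y (\sum_(i <- r) F i) = \sum_(i <- r) ell2_inner y (F i).
Proof.
elim/big_rec2: _ => [|i z w _ <-]; last by rewrite innerDr.
by rewrite -[X in ell2_inner _ X](scale0r y) innerZr conjc0 mul0r.
Qed.

Lemma Re_sum (I : Type) (r : seq I) (F : I -> R[i]) :
  complex.Re (\sum_(i <- r) F i) = \sum_(i <- r) complex.Re (F i).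
Proof. by elim/big_rec2: _ => // i z w _ <-; rewrite ReDc. Qed.

(** Expanding one argument of the inner product writes |s|_2^2 as the sum of the conjugates of [p.1]
    times coefficients of [s]. So a bounded [ell1] norm and uniformly small coefficients force a
    small l^2 norm. *)
Lemma sqr_norm_lsum_le s (M : R) :
  (forall p, p \in s -> normc (coef (lsum s) p.2) <= M) ->
  ell2_norm (lsum s (delta R 1%g)) ^+ 2 <= ell1 s * M.
Proof.
move=> sM; rewrite -inner_self [X in ell2_inner _ X]lsum_delta1 inner_sumr.
rewrite Re_sum /ell1 mulr_suml !big_seq; apply: ler_sum => p ps.
rewrite innerZr inner_delta; apply: le_trans (ler_norm _) _.
apply: le_trans (Re_le_normc _) _; rewrite normcM normc_conjc.
by rewrite ler_wpM2l// sM.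
Qed.

Definition adj_seq s :=
  [seq (conjc p.1 * (sigma p.2 p.2^-1%g)^-1, p.2^-1%g) | p <- s].

Lemma inner_lsum s x y : ell2_inner (lsum s x) y = ell2_inner x (lsum (adj_seq s) y).
Proof.
rewrite /lsum big_map inner_suml inner_sumr; apply: eq_bigr => p _ /=.
by rewrite -scalerA innerZl innerZr conjcK inner_lamV.
Qed.

Definition mul_seq s t :=
  [seq (p.1 * q.1 * sigma p.2 q.2, (p.2 * q.2)%g) | p <- s, q <- t].

Lemma lsum_mul s t x : lsum s (lsum t x) = lsum (mul_seq s t) x.
Proof.
rewrite /lsum big_allpairs_dep; apply: eq_bigr => p _.
rewrite lambda_sum scaler_sumr; apply: eq_bigr => q _ /=.
by rewrite lambdaZ lambda_mul !scalerA.
Qed.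

Definition halfc : R[i] := Complex 2^-1 0.

Lemma normc_halfc : normc halfc = 2^-1.
Proof. by rewrite /halfc /= expr0n addr0 sqrtr_sqr ger0_norm// invr_ge0. Qed.

Lemma Re_halfc c : complex.Re (halfc * c) = 2^-1 * complex.Re c.
Proof. by rewrite ReMc /= mul0r subr0. Qed.

(** The dyadic convex combinations of the maps [Ad g]. Midpoints suffice below, and each property of
    averages becomes an induction with three cases. *)
Inductive averaging : (operator R G -> operator R G) -> Prop :=
| averaging_id : averaging id
| averaging_half F F' : averaging F -> averaging F' ->
    averaging (fun T x => halfc *: (F T x + F' T x))
| averaging_Ad g F : averaging F -> averaging (fun T => Ad g (F T)).

Lemma averaging_comp F F' : averaging F -> averaging F' ->
  averaging (fun T => F (F' T)).
Proof.
move=> aF aF'; elim: aF => {F} [|F1 F2 _ h1 _ h2|g F _ h]//.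
  exact: averaging_half.
exact: averaging_Ad.
Qed.

Lemma averaging_linear F c a b : averaging F ->
  F (fun x => c *: a x + b x) = (fun x => c *: F a x + F b x).
Proof.
elim => {F} [//|F1 F2 _ h1 _ h2|g F _ h]; apply/funext => x.
  by rewrite h1 h2 addrACA -scalerDr [LHS]scalerDr !scalerA [halfc * c]mulrC.
by rewrite h /Ad lambdaD lambdaZ.
Qed.

Lemma averaging_id_op F : averaging F -> F (fun x => x) = (fun x => x).
Proof.
elim => {F} [//|F1 F2 _ h1 _ h2|g F _ h]; apply/funext => x.
  rewrite h1 h2 -mulr2n -scaler_nat scalerA.
  rewrite (_ : halfc * 2%:R = 1) ?scale1r//.
  rewrite /halfc (_ : 2%:R = Complex 2 0 :> R[i]); last first.
    by rewrite -[Complex 2 0]/((2 : R)%:C)%C rmorphMn.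
  by rewrite /GRing.mul/=; congr Complex; field.
by rewrite h /Ad lamVK.
Qed.

Lemma averaging0 F : averaging F -> F (fun=> 0) = (fun=> 0).
Proof.
elim => {F} [//|F1 F2 _ h1 _ h2|g F _ h]; apply/funext => x.
  by rewrite h1 h2 addr0 scaler0.
by rewrite h /Ad lambda0.
Qed.

Lemma averagingZ F c a : averaging F -> F (fun x => c *: a x) = (fun x => c *: F a x).
Proof.
move=> aF; rewrite -[in LHS](_ : (fun x => c *: a x + 0) = (fun x => c *: a x)).
  by rewrite averaging_linear// averaging0//; apply/funext => x; rewrite addr0.
by apply/funext => x; rewrite addr0.
Qed.

Lemma averagingD F a b : averaging F -> F (fun x => a x + b x) = (fun x => F a x + F b x).
Proof.
move=> aF; rewrite -[in LHS](_ : (fun x => 1 *: a x + b x) = (fun x => a x + b x)).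
  by rewrite averaging_linear//; apply/funext => x; rewrite scale1r.
by apply/funext => x; rewrite scale1r.
Qed.

Lemma averaging_sum (I : Type) (r : seq I) (a_ : I -> operator R G) F :
  averaging F ->
  F (fun x => \sum_(i <- r) a_ i x) = (fun x => \sum_(i <- r) F (a_ i) x).
Proof.
move=> aF; elim: r => [|i r IH].
  rewrite [in LHS](_ : (fun x => _) = fun=> 0).
    by rewrite averaging0//; apply/funext => x; rewrite big_nil.
  by apply/funext => x; rewrite big_nil.
rewrite [in LHS](_ : (fun x => _) = fun x => a_ i x + \sum_(i <- r) a_ i x).
  by rewrite averagingD// IH; apply/funext => x; rewrite big_cons.
by apply/funext => x; rewrite big_cons.
Qed.

Lemma averaging_bounded F a (M : R) : averaging F -> bounded_by a M ->
  bounded_by (F a) M.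
Proof.
move=> aF aM; elim: aF => {F} [//|F1 F2 _ h1 _ h2|g F _ h] x.
  rewrite ell2_normZ normc_halfc; apply: le_trans (ler_wpM2l _ (ell2_norm_triangle _ _)) _.
    by rewrite invr_ge0.
  by have := h1 x; have := h2 x; lra.
by rewrite /Ad norm_lambda -(norm_lamV g x).
Qed.

(* Kadison-Schwarz: with [B = b^* b] the hypothesis is an equality, and
   the square of the norm is convex. *)
Lemma averaging_schwarz F b B : averaging F ->
  (forall x, ell2_norm (b x) ^+ 2 <= complex.Re (ell2_inner (B x) x)) ->
  forall x, ell2_norm (F b x) ^+ 2 <= complex.Re (ell2_inner (F B x) x).
Proof.
move=> aF bB; elim: aF => {F} [//|F1 F2 _ h1 _ h2|g F _ h] x.
  rewrite ell2_normZ innerZl innerDl exprMn normc_halfc Re_halfc ReDc.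
  have := h1 x; have := h2 x.
  have := sqr_ge0 (ell2_norm (F1 b x - F2 b x)).
  rewrite (ell2_normB_sq (F1 b x) (F2 b x)) (ell2_normB_sq (F1 b x) (- F2 b x)) ell2_normN.
  have -> : complex.Re (ell2_inner (F1 b x) (- F2 b x)) =
            - complex.Re (ell2_inner (F1 b x) (F2 b x)).
    by rewrite innerC -scaleN1r innerZl innerC; case: (ell2_inner _ _) => p q /=; ring.
  move: (ell2_norm (F1 b x)) (ell2_norm (F2 b x)) => p q.
  move: (complex.Re _) (complex.Re _) (complex.Re _) => u v w.
  by clear; nra.
by rewrite /Ad norm_lambda inner_lamV.
Qed.

(** The sets [X] closed under conjugation record the support: averages of [lambda x] remain finite
    sums over the class of [x], with [ell1] at most 1. *)
Lemma averaging_lsum F s : averaging F -> exists t, [/\ F (lsum s) = lsum t,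
  ell1 t <= ell1 s & forall X : set G, (forall k g, X k -> X (k ^ g)%g) ->
    (forall p, p \in s -> X p.2) -> forall p, p \in t -> X p.2].
Proof.
elim => {F} [|F1 F2 _ [t1 [e1 l1 X1]] _ [t2 [e2 l2 X2]]|g F _ [t [e l Xt]]].
- by exists s; split.
- exists (lscale halfc (t1 ++ t2)); split.
  + by apply/funext => x; rewrite e1 e2 lsum_scale lsum_cat.
  + by rewrite ell1_scale ell1_cat normc_halfc; lra.
  + move=> X XJ Xs p /mapP[q] /[swap] -> /=; rewrite mem_cat => /orP[].
      exact: (X1 X XJ Xs).
    exact: (X2 X XJ Xs).
- exists (conj_seq g t); split.
  + by rewrite e Ad_lsum.
  + by rewrite ell1_conj.
  + by move=> X XJ Xs p /mapP[q qt ->] /=; apply: (XJ); exact: (Xt X XJ Xs).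
Qed.

(** [T] averages to zero, even after any preliminary averaging [F]. That clause makes nullity
    additive: the second summand is averaged after the first one, and averaging does not increase a
    bound already obtained. *)
Definition null T := forall F, averaging F -> forall e : R, 0 < e ->
  exists F', averaging F' /\ bounded_by (F' (F T)) e.

Lemma null0 : null (fun=> 0).
Proof.
move=> F aF e e0; exists id; split; first exact: averaging_id.
by move=> x; rewrite averaging0// ell2_norm0 mulr_ge0// ltW.
Qed.

Lemma nullD a b : null a -> null b -> null (fun x => a x + b x).
Proof.
move=> na nb F aF e e0; have e2 : 0 < e / 2 by rewrite divr_gt0.
have [F1 [aF1 h1]] := na F aF _ e2.
have [F2 [aF2 h2]] := nb _ (averaging_comp aF1 aF) _ e2.
exists (fun T => F2 (F1 T)); split; first exact: averaging_comp.
move=> x; rewrite !averagingD//; apply: le_trans (ell2_norm_triangle _ _) _.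
by have := averaging_bounded aF2 h1 x; have := h2 x; lra.
Qed.

Lemma nullZ c a : null a -> null (fun x => c *: a x).
Proof.
move=> na F aF e e0; have c1 : 0 < normc c + 1 by rewrite ltr_wpDl.
have [F1 [aF1 h1]] := na F aF _ (divr_gt0 e0 c1).
exists F1; split=> // x; rewrite !averagingZ// ell2_normZ.
apply: le_trans (ler_wpM2l (normc_ge0 _) (h1 x)) _; rewrite mulrA ler_wpM2r//.
by rewrite mulrA ler_pdivrMr// mulrC ler_wpM2l// ?ltW// ltrDl.
Qed.

Lemma null_lsum s : (forall p, p \in s -> null (lam p.2)) -> null (lsum s).
Proof.
elim: s => [|p s IH] ns.
  by rewrite (_ : lsum _ = fun=> 0); [exact: null0|apply/funext => x; exact: lsum_nil].
rewrite (_ : lsum _ = fun x => p.1 *: lam p.2 x + lsum s x).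
  apply: nullD; first by apply: nullZ; apply: ns; rewrite mem_head.
  by apply: IH => q qs; apply: ns; rewrite inE qs orbT.
by apply/funext => x; rewrite lsum_cons.
Qed.

Lemma null_family (I : eqType) (r : seq I) (a_ : I -> operator R G) (e : R) :
  0 < e -> (forall i, i \in r -> null (a_ i)) ->
  exists F, averaging F /\ forall i, i \in r -> bounded_by (F (a_ i)) e.
Proof.
move=> e0; elim: r => [|i r IH] nr; first by exists id; split=> //; exact: averaging_id.
have [|F [aF h]] := IH; first by move=> j jr; apply: nr; rewrite inE jr orbT.
have [|F' [aF' h']] := nr i _ F aF e e0; first by rewrite mem_head.
exists (fun T => F' (F T)); split; first exact: averaging_comp.
move=> j; rewrite inE => /orP[/eqP->//|jr].
by apply: averaging_bounded => //; exact: h.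
Qed.

End TwistedOperators.

(** * Averages of a single translation *)

Section Twist.
Variables (R : realType) (G : groupType) (sigma : two_cocycle R G).
Implicit Types g h k x y : G.
Local Notation tw := (twist sigma).

(** This is Ad(gh) = Ad(g) Ad(h) evaluated on lambda(x); it comes from three instances of the
    cocycle identity. *)
Lemma twistM g h x : tw (g * h)%g x = tw g (x ^ h^-1)%g * tw h x.
Proof.
rewrite /twist; set x' := (x ^ h^-1)%g.
have -> : (x ^ (g * h)^-1)%g = (x' ^ g^-1)%g by rewrite invgM conjgM.
set x'' := (x' ^ g^-1)%g.
have hx : (h * x = x' * h)%g by rewrite /x' -conjgCV.
have gx : (g * x' = x'' * g)%g by rewrite /x'' -conjgCV.
have e1 := cocycle_eq sigma g h x.
have e2 := cocycle_eq sigma x'' g h.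
have e3 := cocycle_eq sigma g x' h.
rewrite hx in e1; rewrite gx in e3.
have n0 a b := cocycle_neq0 sigma a b.
rewrite mulf_div; apply/eqP; rewrite eqr_div ?mulf_neq0//; apply/eqP.
apply: (mulfI (n0 g h)); apply: (mulfI (n0 (x'' * g)%g h)).
move: e1 e2 e3 (n0 g h).
move: (sigma g h) (sigma (g * h)%g x) (sigma g (x' * h)%g) (sigma h x)
  (sigma x'' g) (sigma (x'' * g)%g h) (sigma x'' (g * h)%g) (sigma g x') (sigma x' h).
clear => a b c d e f i j k e1 e2 e3 _.
transitivity (f * (a * b) * (e * k)); first by ring.
rewrite e1; transitivity ((c * k) * d * (e * f)); first by ring.
by rewrite -e3 e2; ring.
Qed.

Lemma twist1 x : tw 1%g x = 1.
Proof. by rewrite /twist cocycle_1g cocycle_g1 invr1 mulr1. Qed.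

Lemma twist_neq0 g x : tw g x != 0.
Proof. by rewrite mulf_neq0 ?invr_eq0 ?cocycle_neq0. Qed.

Lemma commute_conjgV g x : commute x g -> (x ^ g^-1)%g = x.
Proof. by move=> c; rewrite conjgE invgK mulgA -c mulgK. Qed.

Lemma commute_conjg g x : commute x g -> (x ^ g)%g = x.
Proof. by move=> c; rewrite conjgE c mulKg. Qed.

Lemma conjg_commute g x : (x ^ g)%g = x -> commute x g.
Proof. by move=> c; rewrite /commute conjgC c. Qed.

(** Ad(g) is multiplicative: compare its values on lambda(x) lambda(y) and on sigma(x, y)
    lambda(xy). *)
Lemma twist_mulr g x y :
  tw g (x * y)%g * sigma x y = tw g x * tw g y * sigma (x ^ g^-1)%g (y ^ g^-1)%g.
Proof.
rewrite /twist conjMg; set x' := (x ^ _)%g; set y' := (y ^ _)%g.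
have gx : (g * x = x' * g)%g by rewrite /x' -conjgCV.
have gy : (g * y = y' * g)%g by rewrite /y' -conjgCV.
have e1 := cocycle_eq sigma g x y.
have e2 := cocycle_eq sigma x' g y.
have e3 := cocycle_eq sigma x' y' g.
rewrite gx in e1; rewrite gy in e2.
have n0 a b := cocycle_neq0 sigma a b.
rewrite mulf_div [LHS]mulrAC [RHS]mulrAC; apply/eqP.
rewrite eqr_div ?mulf_neq0//; apply/eqP.
apply: (mulfI (n0 (x' * g)%g y)); move: e1 e2 e3.
move: (sigma g x) (sigma (x' * g)%g y) (sigma g (x * y)%g) (sigma x y)
  (sigma x' g) (sigma x' (y' * g)%g) (sigma g y) (sigma x' y') (sigma (x' * y')%g g)
  (sigma y' g).
clear => a b c d e f i j k l e1 e2 e3.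
transitivity ((c * d) * (e * b) * l); first by ring.
rewrite -e1 e2; transitivity (b * a * i * (j * k)); last by ring.
by rewrite e3; ring.
Qed.

Lemma twist_commuteE g x : commute x g -> tw g x = sigma g x / sigma x g.
Proof. by move=> c; rewrite /twist commute_conjgV. Qed.

Lemma twist_eq1 g x : commute x g -> tw g x = 1 <-> sigma x g = sigma g x.
Proof.
move=> c; rewrite twist_commuteE//; have n0 := cocycle_neq0 sigma x g.
split=> [/(congr1 (fun z => z * sigma x g))|<-]; last by rewrite divff.
by rewrite divfK// mul1r.
Qed.

Lemma twistM_commute g h x : commute x g -> commute x h ->
  tw (g * h)%g x = tw g x * tw h x.
Proof. by move=> cg ch; rewrite twistM commute_conjgV. Qed.

Lemma twist_mulr_commute g x y : commute x g -> commute y g ->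
  tw g (x * y)%g = tw g x * tw g y.
Proof.
move=> cx cy; have := twist_mulr g x y; rewrite !commute_conjgV//.
exact/mulIf/cocycle_neq0.
Qed.

(** Apply [twistM] to both sides of g^k k^-1 = k^-1 g. *)
Lemma twistJ g x k : commute x g -> tw (g ^ k)%g (x ^ k)%g = tw g x.
Proof.
move=> c; apply: (mulIf (twist_neq0 k^-1 x)).
have {1}-> : (x ^ k)%g = (x ^ k^-1^-1)%g by rewrite invgK.
by rewrite -twistM (_ : (g ^ k * k^-1 = k^-1 * g)%g) ?twistM ?commute_conjgV 1?mulrC//
   -?twistM_commute// conjgE -!mulgA mulgV mulg1.
Qed.

(** For commuting elements [tw h x] is sigma(h, x) / sigma(x, h). It is preferred to the cocycle
    itself since on commuting pairs it is multiplicative in each variable. *)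
Definition kleppner : Prop := forall x, x != 1%g -> finite_set (conj_class x) ->
  exists h, commute x h /\ tw h x != 1.

End Twist.

(** * Normal subgroups and classes that are finite modulo them *)

Section NormalSets.
Variable G : groupType.
Implicit Types (N : set G) (x y g : G).

(** Normal subgroups as sets rather than as [groupClosed] predicates, so that Zorn's lemma applies
    to unions of chains. *)
Record normal_set N : Prop := NormalSet {
  normal_set1 : N 1%g;
  normal_setM : forall x y, N x -> N y -> N (x * y)%g;
  normal_setV : forall x, N x -> N x^-1%g;
  normal_setJ : forall x g, N x -> N (x ^ g)%g }.

(** For a normal [N] this says that [x] has a finite conjugacy class in the quotient by [N], without
    forming that quotient. *)
Definition finite_class_mod N x : Prop :=
  exists Y : seq G, forall g, exists2 y, y \in Y & N (y^-1 * x ^ g)%g.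

Lemma normal_set_div N x y z : normal_set N -> N (z^-1 * x)%g -> N (z^-1 * y)%g ->
  N (x^-1 * y)%g.
Proof.
move=> nN /(normal_setV nN) hx hy; have := normal_setM nN hx hy.
by rewrite invgM invgK mulgA mulgK.
Qed.

End NormalSets.

(** * The inductive step: translations with a finite class modulo a normal subgroup *)

Section NullStep.
Variables (R : realType) (G : groupType) (sigma : two_cocycle R G).
Implicit Types g h x y : G.
Implicit Type k : nat.
Local Notation lam := (lambda sigma).
Local Notation tw := (twist sigma).
Local Notation lsum := (lsum sigma).
Local Notation Ad := (Ad sigma).
Local Notation averaging := (averaging sigma).
Local Notation null := (null sigma).
Local Notation delta1 := (delta R (1 : G)%g).

Let normc_pos (c : R[i]) : 0 <= normc c. Proof. exact: normc_ge0. Qed.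
Let norm_pos (v : ell2 R G) : 0 <= ell2_norm v. Proof. exact: ell2_norm_ge0. Qed.
Hint Resolve normc_pos norm_pos : core.

Definition moved_class x := infinite_set (conj_class x) \/
  exists h, commute x h /\ tw h x != 1.

(** The coefficient at y and the twisted coefficient at y^g differ by at most [e]. If the class is
    infinite, y^g can be taken outside the finite support. Otherwise a conjugate of [h] commutes
    with y and multiplies its coefficient by a fixed scalar different from 1. *)
Lemma almost_invariant_coef x (e : R) (C : R) s :
  (forall p, p \in s -> conj_class x p.2) ->
  (forall g, ell2_norm (lsum s delta1 - Ad g (lsum s) delta1) <= e) ->
  1 <= C ->
  (infinite_set (conj_class x) \/
     exists h, [/\ commute x h, tw h x != 1 & (normc (1 - tw h x))^-1 <= C]) ->
  forall p, p \in s -> normc (coef (lsum s) p.2) <= C * e.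
Proof.
move=> sx inv C1 mv p ps; have [l _ ly] := sx p ps.
move: (p.2) ly => y ly {p ps}.
have e0 : 0 <= e by exact: le_trans (inv 1%g).
have key g : normc (coef (lsum s) y - tw g (y ^ g)%g * coef (lsum s) (y ^ g)%g) <= e.
  apply: le_trans (inv g); rewrite -coef_Ad.
  by apply: le_trans (normc_le_ell2 _ y); rewrite ell2D ell2N.
have [inf|[h [ch twh hC]]] := mv.
  have [z [[k _ kz] zs]] : exists z, conj_class x z /\ z \notin [seq p.2 | p <- s].
    apply: contrapT => nz; apply: inf; apply: (@sub_finite_set _ _ [set` [seq p.2 | p <- s]]).
      move=> z xz /=; apply/negP => /negP zs; apply: nz; by exists z.
    exact: finite_seq.
  have yz : (y ^ (l^-1 * k))%g = z by rewrite -ly -conjgM mulVKg.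
  have := key (l^-1 * k)%g; rewrite yz.
  have -> : coef (lsum s) z = 0.
    rewrite coef_lsum big_seq_cond big1// => p /andP[ps /eqP pz].
    by move: zs; rewrite -pz map_f.
  by rewrite mulr0 subr0 => /le_trans; apply; rewrite ler_peMl.
have cl : commute y (h ^ l)%g by rewrite /commute -ly -!conjMg ch.
have tl : tw (h ^ l)%g y = tw h x by rewrite -ly twistJ.
have := key (h ^ l)%g; rewrite (commute_conjg cl) tl.
rewrite -{1}[coef _ _]mul1r -mulrBl normcM => hy.
have n0 : 0 < normc (1 - tw h x).
  rewrite lt_def normc_pos andbT; apply/eqP => /eq0_normc/eqP.
  by rewrite subr_eq0 eq_sym (negbTE twh).
apply: (@le_trans _ _ ((normc (1 - tw h x))^-1 * e)); last by rewrite ler_wpM2r.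
by rewrite -ler_pdivrMl ?invr_gt0// invrK.
Qed.

Lemma averaged_norm_small x F (eta : R) : moved_class x -> averaging F -> 0 < eta ->
  exists F', averaging F' /\ ell2_norm (F' (F (lam x)) delta1) ^+ 2 < eta.
Proof.
move=> mx aF eta0; set a := F (lam x).
have [C C1 CP] : exists2 C : R, 1 <= C & (infinite_set (conj_class x) \/
     exists h, [/\ commute x h, tw h x != 1 & (normc (1 - tw h x))^-1 <= C]).
  case: mx => [inf|[h [ch th]]]; first by exists 1 => //; left.
  exists (1 + (normc (1 - tw h x))^-1); first by rewrite lerDl invr_ge0.
  by right; exists h; split=> //; rewrite lerDr.
apply: contrapT => H.
pose S : set R := [set r | exists2 F', averaging F' & r = ell2_norm (F' a delta1) ^+ 2].
have Sge r : S r -> eta <= r.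
  by move=> [F' aF' ->]; rewrite leNgt; apply/negP => h; apply: H; exists F'.
have S0 : S !=set0 by exists (ell2_norm (a delta1) ^+ 2), id => //; exact: averaging_id.
have infS : has_inf S by split=> //; exists eta.
set d := inf S; have dS r : S r -> d <= r by move=> Sr; apply: ge_inf => //; exists eta.
(* Chosen so that [C * (2 * e) = eta / 2], where [2 * e] is the defect of invariance found below. *)
pose e := eta / (4 * C).
have C0 : 0 < C by exact: lt_le_trans C1.
have e0 : 0 < e by rewrite divr_gt0// mulr_gt0.
have [_ [F' aF' ->] F'd] := inf_adherent (exprn_gt0 2 e0) infS.
have [t [eF l1t Xt]] : exists t, [/\ F' a = lsum t, ell1 t <= 1 &
    forall p, p \in t -> conj_class x p.2].
  have [t [et lt Xt]] := averaging_lsum [:: (1, x)] (averaging_comp aF' aF).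
  exists t; split.
  - rewrite -et /a; congr (F' (F _)); apply/funext => v.
    by rewrite lsum1 scale1r.
  - by apply: le_trans lt _; rewrite /ell1 big_seq1 normc1.
  - apply: Xt => [y g [k _ <-]|p]; first by exists (k * g)%g; rewrite // conjgM.
    by rewrite inE => /eqP -> /=; exists 1%g; rewrite // conjg1.
set v := lsum t delta1 in eF *.
(* By the parallelogram law |v - w|^2 = 4|v|^2 - 4|(v + w)/2|^2, as |w| = |v|. The midpoint is again
   an average, so its squared norm is at least [d], while |v|^2 < d + e^2. *)
have inv g : ell2_norm (v - Ad g (lsum t) delta1) <= 2 * e.
  set w := Ad g _ _; have wv : ell2_norm w = ell2_norm v by exact: norm_Ad_delta.
  have : d <= ell2_norm (halfc R *: (v + w)) ^+ 2.
    apply: dS; exists (fun T (u : ell2 R G) => halfc R *: (F' T u + Ad g (F' T) u)).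
      by apply: averaging_half => //; exact: averaging_Ad.
    by rewrite eF.
  rewrite ell2_normZ normc_halfc exprMn (ell2_normB_sq v w) wv => dle.
  rewrite eF in F'd.
  have e20 : 0 <= 2 * e by rewrite mulr_ge0 ?ltW.
  rewrite -ler_sqr ?nnegrE// (ell2_normB_sq v (- w)) ell2_normN wv.
  have -> : complex.Re (ell2_inner v (- w)) = - complex.Re (ell2_inner v w).
    by rewrite innerC -scaleN1r innerZl innerC; case: (ell2_inner _ _) => p q /=; ring.
  rewrite -/v in F'd; move: F'd dle; rewrite -/d.
  move: (ell2_norm v) (complex.Re _) => p q; clear; nra.
(* The coefficients are at most 2Ce, so |v|^2 <= eta / 2, below the supposed lower bound [eta]. *)
have := sqr_norm_lsum_le (almost_invariant_coef Xt inv C1 CP).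
rewrite -/v => h; have := Sge _ (ex_intro2 _ _ F' aF' erefl); rewrite eF -/v => h'.
have : ell1 t * (C * (2 * e)) <= eta / 2.
  rewrite (_ : C * (2 * e) = eta / 2); last by rewrite /e; field; rewrite gt_eqF.
  by rewrite ler_piMl// divr_ge0// ltW.
by move: h h'; clear -eta0; lra.
Qed.

Lemma null_step (N : set G) x : normal_set N ->
  (forall y, N y -> y != 1%g -> null (lam y)) ->
  finite_class_mod N x -> moved_class x -> null (lam x).
Proof.
move=> nN nullN [Y Yx] mx F aF e e0; set m := size Y.
have m0 : 0 < m%:R + 1 :> R by rewrite ltr_wpDl.
(* Each of the [m] cosets will contribute at most sqrt(2 eta) = e / (m + 1) to the norm. *)
pose eta := (e / (m%:R + 1)) ^+ 2 / 2.
have eta0 : 0 < eta by rewrite divr_gt0// exprn_gt0// divr_gt0.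
have [F1 [aF1 small]] := averaged_norm_small mx aF eta0.
have [t [eF Xt]] : exists t, F1 (F (lam x)) = lsum t /\
    forall p, p \in t -> conj_class x p.2.
  have [t [et _ Xt]] := averaging_lsum [:: (1, x)] (averaging_comp aF1 aF).
  exists t; split.
  - rewrite -et; congr (F1 (F _)); apply/funext => v.
    by rewrite lsum1 scale1r.
  - apply: Xt => [y g [k _ <-]|p]; first by exists (k * g)%g; rewrite // conjgM.
    by rewrite inE => /eqP -> /=; exists 1%g; rewrite // conjg1.
(* A coset is labelled by an index in [Y]. [find] returns [m] when there is no representative, which
   [cosetP] excludes on the support of [t]. *)
pose coset y := find (fun z => `[< N (z^-1 * y)%g >]) Y.
have cosetP p : p \in t -> (coset p.2 < m)%N /\ N ((nth 1%g Y (coset p.2))^-1 * p.2)%g.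
  move=> /Xt[g _ <-]; have [y yY Ny] := Yx g.
  have hY : has (fun z => `[< N (z^-1 * x ^ g)%g >]) Y.
    by apply/hasP; exists y => //; apply/asboolP.
  by rewrite /coset -has_find; split=> //; apply/asboolP; exact: (nth_find 1%g hY).
pose tk (k : nat) := [seq p <- t | coset p.2 == k].
have tE v : lsum t v = \sum_(k <- iota 0 m) lsum (tk k) v.
  under [RHS]eq_bigr do rewrite lsumE /tk big_filter big_mkcond/=.
  rewrite exchange_big/= lsumE big_seq [RHS]big_seq; apply: eq_bigr => p pt.
  have [pm _] := cosetP p pt.
  rewrite (bigD1_seq (coset p.2)) ?mem_iota ?iota_uniq//= eqxx big1 ?addr0// => k.
  by rewrite eq_sym => /negbTE ->.
(* [rk k] is b^* b for the piece b = [tk k]; its letters p^-1 q, with p and q in the same coset, lie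
   in [N]. *)
pose rk k := mul_seq sigma (adj_seq sigma (tk k)) (tk k).
have rkN k p : p \in rk k -> N p.2.
  move=> /allpairsP[[p1 p2]] /= [/mapP[q]].
  rewrite !mem_filter => /andP[/eqP qk qt] -> /andP[/eqP pk pt] -> /=.
  apply: (@normal_set_div _ _ _ _ (nth 1%g Y k)) => //.
    by rewrite -qk; apply: (cosetP q qt).2.
  by rewrite -pk; apply: (cosetP p2 pt).2.
have rkE k v : complex.Re (ell2_inner (lsum (rk k) v) v) = ell2_norm (lsum (tk k) v) ^+ 2.
  by rewrite -lsum_mul innerC -inner_lsum -inner_self; case: (ell2_inner _ _).
pose ck k : R[i] := coef (lsum (rk k)) 1%g.
pose sk k := [seq p <- rk k | p.2 != 1%g].
have rkS k : lsum (rk k) = fun v => ck k *: v + lsum (sk k) v := lsum_split1 sigma (rk k).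
(* The coefficient of b^* b at 1 is |b|_2^2, and restricting [t] to one coset does not increase the
   l^2 norm. *)
have ckE k : complex.Re (ck k) < eta.
  rewrite /ck /coef -inner_delta rkE; apply: le_lt_trans small; rewrite eF.
  rewrite ler_sqr ?nnegrE//; apply: ell2_norm_le => y.
  rewrite -/(coef _ _) -/(coef (lsum t) y) !coef_lsum big_filter_cond.
  have [yk|yk] := eqVneq (coset y) k.
    rewrite (eq_bigl (fun p : R[i] * G => p.2 == y)) ?lexx// => p /=.
    by rewrite andb_idl// => /eqP ->; apply/eqP.
  rewrite big1 ?normc0// => p /andP[/eqP pk /eqP py].
  by rewrite -pk py eqxx in yk.
(* Every translation by an element of [N] other than 1 is null, so a single average brings all the
   remainders [sk k] down to [eta]. *)
have [F2 [aF2 hF2]] : exists F2, averaging F2 /\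
    forall k, k \in iota 0 m -> bounded_by (F2 (lsum (sk k))) eta.
  apply: null_family => // k _; apply: null_lsum => p; rewrite mem_filter.
  by move=> /andP[p1 pr]; apply: nullN => //; exact: rkN pr.
exists (fun T => F2 (F1 T)); split; first exact: averaging_comp.
move=> v; rewrite eF (_ : lsum t = fun v => \sum_(k <- iota 0 m) lsum (tk k) v); last first.
  by apply/funext.
rewrite (averaging_sum _ _ aF2); apply: le_trans (ell2_norm_sum _ _) _.
apply: (@le_trans _ _ (\sum_(k <- iota 0 m) (e / (m%:R + 1)) * ell2_norm v)).
  rewrite big_seq [leRHS]big_seq; apply: ler_sum => k km.
  rewrite -ler_sqr ?nnegrE ?mulr_ge0 ?invr_ge0 ?(ltW m0) ?(ltW e0)//.
  (* Kadison-Schwarz: |F2(b) v|^2 <= Re <F2(b^* b) v, v>, where b^* b is the scalar [ck k] plus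
     [sk k]; each part contributes at most eta |v|^2. *)
  have := averaging_schwarz aF2 (b := lsum (tk k)) (B := lsum (rk k)).
  move=> /(_ (fun w => _))/(_ v) h; apply: le_trans (h _) _.
    by move=> w; rewrite rkE.
  rewrite rkS (averaging_linear _ _ _ aF2) (averaging_id_op aF2) innerDl ReDc innerZl.
  have -> : complex.Re (ck k * ell2_inner v v) = complex.Re (ck k) * ell2_norm v ^+ 2.
    rewrite ReMc inner_self (_ : complex.Im (ell2_inner v v) = 0) ?mulr0 ?subr0//.
    by have := innerC v v; case: (ell2_inner v v) => p q [] /=; lra.
  have cs := cauchy_schwarz (F2 (lsum (sk k)) v) v.
  have := hF2 k km v; have := ckE k; have := norm_pos v.
  rewrite exprMn (_ : (e / _) ^+ 2 = 2 * eta); last by rewrite /eta; field; rewrite gt_eqF.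
  move: cs; move: (complex.Re (ell2_inner _ _)) (complex.Re (ck k)) => p q.
  move: (ell2_norm (F2 _ v)) (ell2_norm v) => u w.
  by clear; nra.
rewrite big_const_seq count_predT size_iota iter_addr addr0 -[leLHS]mulr_natl mulrA.
apply: ler_wpM2r => //; rewrite mulrCA ler_piMr ?(ltW e0)//.
by rewrite ler_pdivrMr// mul1r lerDl ler01.
Qed.

End NullStep.

(** * Ideals of the reduced algebra *)

Section BoundedOperators.
Variables (R : realType) (G : groupType).
Implicit Types (x y : ell2 R G) (c : R[i]) (T S : operator R G).

Let normc_pos c : 0 <= normc c. Proof. exact: normc_ge0. Qed.
Let norm_pos x : 0 <= ell2_norm x. Proof. exact: ell2_norm_ge0. Qed.
Hint Resolve normc_pos norm_pos : core.

Lemma normc_real (r : R) : 0 <= r -> normc (r%:C)%C = r.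
Proof. by move=> r0; rewrite /= expr0n addr0 sqrtr_sqr ger0_norm. Qed.

Lemma bounded_by_le T (M M' : R) : M <= M' -> bounded_by T M -> bounded_by T M'.
Proof. by move=> MM' TM x; apply: le_trans (TM x) _; rewrite ler_wpM2r. Qed.

Lemma bounded_opP T : bounded_op T ->
  linear T /\ exists2 M : R, 0 <= M & bounded_by T M.
Proof.
move=> [lT [M TM]]; split=> //; exists (Num.max M 0); first by rewrite le_max lexx orbT.
by apply: bounded_by_le TM; rewrite le_max lexx.
Qed.

Lemma linear_op0 T : linear T -> T 0 = 0.
Proof. by move=> lT; have := lT (-1) 0 0; rewrite !scaleN1r !addNr. Qed.

Lemma linear_opZ T c x : linear T -> T (c *: x) = c *: T x.
Proof. by move=> lT; have := lT c x 0; rewrite !addr0 linear_op0// addr0. Qed.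

Lemma linear_opD T x y : linear T -> T (x + y) = T x + T y.
Proof. by move=> lT; have := lT 1 x y; rewrite !scale1r. Qed.

Lemma linear_opB T x y : linear T -> T (x - y) = T x - T y.
Proof. by move=> lT; rewrite linear_opD// -scaleN1r linear_opZ// scaleN1r. Qed.

Lemma bounded_by_eq0 T : (forall e : R, 0 < e -> bounded_by T e) -> forall x, T x = 0.
Proof.
move=> Te x; apply: ell2_norm_eq0; apply/eqP; rewrite eq_le norm_pos andbT.
apply/ler_addgt0Pl => e e0; rewrite addr0.
have x1 : 0 < ell2_norm x + 1 by rewrite ltr_wpDl.
apply: le_trans (Te (e / (ell2_norm x + 1)) _ x) _; first by rewrite divr_gt0.
rewrite -mulrA ler_piMr ?(ltW e0)//.
by rewrite mulrC ler_pdivrMr// mul1r lerDl.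
Qed.

Lemma bounded_opD T S : bounded_op T -> bounded_op S -> bounded_op (T \+ S).
Proof.
move=> [lT [M TM]] [lS [N SN]]; split.
  by move=> c x y; rewrite /= lT lS scalerDr addrACA.
exists (M + N) => x; rewrite mulrDl.
by apply: le_trans (ell2_norm_triangle _ _) _; rewrite lerD.
Qed.

Lemma bounded_opZ c T : bounded_op T -> bounded_op (fun x => c *: T x).
Proof.
move=> [lT [M TM]]; split.
  by move=> d x y; rewrite /= lT scalerDr !scalerA mulrC.
by exists (normc c * M) => x; rewrite ell2_normZ -mulrA ler_wpM2l.
Qed.

Lemma bounded_opB T S : bounded_op T -> bounded_op S -> bounded_op (T \- S).
Proof.
move=> bT bS; have -> : T \- S = T \+ (fun x => (-1) *: S x).
  by apply/funext => x /=; rewrite scaleN1r.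
by apply: bounded_opD => //; exact: bounded_opZ.
Qed.

Lemma bounded_op_comp T S : bounded_op T -> bounded_op S -> bounded_op (T \o S).
Proof.
move=> /bounded_opP[lT [M M0 TM]] /bounded_opP[lS [N N0 SN]]; split.
  by move=> d x y; rewrite /= lS lT.
by exists (M * N) => x /=; apply: le_trans (TM _) _; rewrite -mulrA ler_wpM2l.
Qed.

Lemma op_norm_le T (M : R) : 0 <= M -> bounded_by T M -> op_norm T <= M.
Proof.
move=> M0 TM; apply: ge_sup; first by exists (ell2_norm (T 0)), 0 => //=; rewrite ell2_norm0.
move=> _ [x /= x1 <-]; apply: le_trans (TM x) _.
by rewrite ler_piMr.
Qed.

Lemma op_norm_has_sup T : bounded_op T ->
  has_sup [set ell2_norm (T x) | x in [set x | ell2_norm x <= 1]].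
Proof.
move=> /bounded_opP[_ [M M0 TM]]; split.
  by exists (ell2_norm (T 0)), 0 => //=; rewrite ell2_norm0.
exists M => _ [x /= x1 <-]; apply: le_trans (TM x) _.
by rewrite ler_piMr.
Qed.

Lemma op_normP T : bounded_op T -> bounded_by T (op_norm T).
Proof.
move=> bT x; have [lT _] := bT; have [x0|xn0] := eqVneq (ell2_norm x) 0.
  by rewrite (ell2_norm_eq0 x0) linear_op0// ell2_norm0 mulr0.
have xp : 0 < ell2_norm x by rewrite lt_def xn0 norm_pos.
pose c := ((ell2_norm x)^-1)%:C%C : R[i].
have nc : normc c = (ell2_norm x)^-1.
  by rewrite normc_real// invr_ge0.
have : ell2_norm (T (c *: x)) <= op_norm T.
  apply: sup_ubound; first by case: (op_norm_has_sup bT).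
  by exists (c *: x) => //=; rewrite ell2_normZ nc mulVf.
by rewrite linear_opZ// ell2_normZ nc mulrC ler_pdivrMr.
Qed.

Lemma norm_closedP (A : set (operator R G)) T : norm_closed A -> bounded_op T ->
  (forall e : R, 0 < e -> exists2 S, A S & bounded_by (T \- S) e) -> A T.
Proof.
move=> cA bT H; apply: cA => // e e0; have e2 : 0 < e / 2 by rewrite divr_gt0.
have [S AS h] := H _ e2; exists S => //.
apply: le_lt_trans (op_norm_le (ltW e2) h) _.
by rewrite ltr_pdivrMr// ltr_pMr// ltr1n.
Qed.

Lemma delta_dense T : bounded_op T -> (forall g, T (delta R g) = 0) -> forall x, T x = 0.
Proof.
move=> /bounded_opP[lT [M M0 TM]] T0 x.
apply: ell2_norm_eq0; apply/eqP; rewrite eq_le norm_pos andbT.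
apply/ler_addgt0Pl => e e0; rewrite addr0.
have M1 : 0 < M + 1 by rewrite ltr_wpDl.
have [s hs] := finite_approx x (divr_gt0 e0 M1).
have Ts : T (\sum_(g <- s) x g *: delta R g) = 0.
  elim: (s) => [|g s' IH]; first by rewrite big_nil linear_op0.
  by rewrite big_cons linear_opD// linear_opZ// T0 scaler0 add0r.
rewrite -[T x]subr0 -Ts -linear_opB//; apply: le_trans (TM _) _.
apply: le_trans (ler_wpM2l M0 hs) _; rewrite mulrCA ler_piMr ?(ltW e0)//.
by rewrite ler_pdivrMr// mul1r lerDl.
Qed.

End BoundedOperators.

(** * The reduced algebra as a norm closure, and simplicity from null translations *)

Section ReducedAlgebra.
Variables (R : realType) (G : groupType) (sigma : two_cocycle R G).
Implicit Types (x y : ell2 R G) (c : R[i]) (T S : operator R G).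
Implicit Types (s t : seq (R[i] * G)) (g h : G).
Local Notation lam := (lambda sigma).
Local Notation lsum := (lsum sigma).
Local Notation A := (reduced_algebra sigma).
Local Notation delta1 := (delta R (1 : G)%g).

Let normc_pos c : 0 <= normc c. Proof. exact: normc_ge0. Qed.
Let norm_pos x : 0 <= ell2_norm x. Proof. exact: ell2_norm_ge0. Qed.
Hint Resolve normc_pos norm_pos : core.

Lemma lsum_bounded_op s : bounded_op (lsum s).
Proof. by split; [exact: lsum_linear|exists (ell1 s); exact: lsum_bounded]. Qed.

Lemma lambda_lsum g : lam g = lsum [:: (1, g)].
Proof. by apply/funext => x; rewrite lsum1 scale1r. Qed.

Lemma inner_lsum_adj s x y :
  ell2_inner (lsum (adj_seq sigma s) x) y = ell2_inner x (lsum s y).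
Proof. by rewrite innerC -inner_lsum -innerC. Qed.

Lemma inner_ext x y : (forall z, ell2_inner x z = ell2_inner y z) -> x = y.
Proof. by move=> h; apply: ell2P => g; rewrite -!inner_delta h. Qed.

(** |Sy|^2 = <T S y, y> <= M |Sy| |y|, and |Sy| cancels unless it vanishes. *)
Lemma bounded_by_adjoint T S (M : R) : adjoint_of T S -> bounded_by T M ->
  bounded_by S M.
Proof.
move=> TS TM y; have [Sy0|Syn0] := eqVneq (ell2_norm (S y)) 0.
  rewrite Sy0; have [M0|/ltW M0] := leP 0 M; first by rewrite mulr_ge0.
  have [y0|yn0] := eqVneq (ell2_norm y) 0; first by rewrite y0 mulr0.
  have yp : 0 < ell2_norm y by rewrite lt_def yn0 norm_pos.
  by have := TM y; apply: le_trans.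
have Syp : 0 < ell2_norm (S y) by rewrite lt_def Syn0 norm_pos.
rewrite -(ler_pM2l Syp) -expr2 -inner_self -TS.
apply: le_trans (cauchy_schwarz _ _) _.
by rewrite mulrCA mulrA ler_wpM2r.
Qed.

(** The reduced algebra is an intersection of subalgebras, which says nothing directly about its
    elements. The norm closure of the finite sums is one of those subalgebras, so every element of
    the reduced algebra is a limit of finite sums. *)
Definition approximable : set (operator R G) :=
  [set T | bounded_op T /\ forall e : R, 0 < e -> exists s, bounded_by (T \- lsum s) e].

Lemma approximable_lsum s : approximable (lsum s).
Proof.
split=> [|e e0]; first exact: lsum_bounded_op.
by exists s => x /=; rewrite subrr ell2_norm0 mulr_ge0// ltW.
Qed.

Lemma approximable_algebra : Cstar_subalgebra approximable.
Proof.
split.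
- by move=> T [].
- rewrite (_ : (fun=> 0) = lsum [::]); first exact: approximable_lsum.
  by apply/funext => x; rewrite lsum_nil.
- move=> S T [bS aS] [bT aT]; split=> [|e e0]; first exact: bounded_opD.
  have e2 : 0 < e / 2 by rewrite divr_gt0.
  have [s hs] := aS _ e2; have [t ht] := aT _ e2; exists (s ++ t) => x /=.
  rewrite lsum_cat opprD addrACA; apply: le_trans (ell2_norm_triangle _ _) _.
  by apply: le_trans (lerD (hs x) (ht x)) _; rewrite -mulrDl -splitr.
- move=> c T [bT aT]; split=> [|e e0]; first exact: bounded_opZ.
  have c1 : 0 < normc c + 1 by rewrite ltr_wpDl.
  have [s hs] := aT _ (divr_gt0 e0 c1); exists (lscale c s) => x /=.
  rewrite lsum_scale -scalerBr ell2_normZ.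
  apply: le_trans (ler_wpM2l (normc_pos _) (hs x)) _; rewrite mulrA ler_wpM2r//.
  rewrite mulrCA ler_piMr ?(ltW e0)//.
  by rewrite ler_pdivrMr// mul1r lerDl.
- move=> S T [bS aS] [bT aT]; split=> [|e e0]; first exact: bounded_op_comp.
  have [lS [M M0 SM]] := bounded_opP bS.
  have M1 : 0 < 2 * (M + 1) by rewrite mulr_gt0// ltr_wpDl.
  (* [T] is approximated first, because the tolerance for [S] depends on [ell1 t]: the error is S (T
     - t) + (S - s) t. *)
  have [t ht] := aT _ (divr_gt0 e0 M1).
  have t1 : 0 < 2 * (ell1 t + 1) by rewrite mulr_gt0// ltr_wpDl// ell1_ge0.
  have [s hs] := aS _ (divr_gt0 e0 t1); exists (mul_seq sigma s t) => x /=.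
  rewrite -lsum_mul (_ : _ - _ = S (T x - lsum t x) + (S \- lsum s) (lsum t x)); last first.
    by rewrite linear_opB//= addrA subrK.
  apply: le_trans (ell2_norm_triangle _ _) _.
  apply: le_trans (lerD (SM _) (hs _)) _.
  apply: le_trans (lerD (ler_wpM2l M0 (ht x)) (ler_wpM2l _ (lsum_bounded sigma t x))) _.
    by rewrite divr_ge0 ?ltW.
  rewrite (_ : _ + _ = e * (M / (2 * (M + 1)) + ell1 t / (2 * (ell1 t + 1))) * ell2_norm x).
    have h (r : R) : 0 < 2 * (r + 1) -> r / (2 * (r + 1)) <= 2^-1.
      by move=> r1; rewrite ler_pdivrMr// mulrA mulVf ?pnatr_eq0// mul1r lerDl.
    apply: ler_wpM2r => //; rewrite ler_piMr ?(ltW e0)//.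
    by rewrite [leRHS](splitr 1) div1r lerD ?h.
  by move: (2 * (M + 1))^-1 (2 * (ell1 t + 1))^-1 => p q; ring.
- move=> S T [bS aS] bT ST; split=> [|e e0]; [exact: bT|]; have [s hs] := aS _ e0.
  exists (adj_seq sigma s); apply: (bounded_by_adjoint _ hs) => x y /=.
  by rewrite innerBl innerBr ST inner_lsum.
- move=> T bT aT; split=> [|e e0]; [exact: bT|]; have e2 : 0 < e / 2 by rewrite divr_gt0.
  have [S [bS aS] TS] := aT _ e2; have [s hs] := aS _ e2; exists s => x /=.
  rewrite (_ : _ - _ = (T \- S) x + (S \- lsum s) x); last by rewrite /= addrA subrK.
  apply: le_trans (ell2_norm_triangle _ _) _.
  apply: le_trans (lerD (op_normP (bounded_opB bT bS) x) (hs x)) _.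
  rewrite -mulrDl ler_wpM2r// [leRHS]splitr lerD2r; exact: ltW.
Qed.

Lemma reduced_approximable T : A T -> approximable T.
Proof.
apply; split; first exact: approximable_algebra.
by move=> _ [g _ <-]; rewrite lambda_lsum; exact: approximable_lsum.
Qed.

Lemma reduced_lambda g : A (lam g).
Proof. by move=> B [_]; apply; exists g. Qed.

Lemma reducedD T S : A T -> A S -> A (T \+ S).
Proof.
by move=> AT AS B [CB lB]; apply: (Cstar_add CB); [exact: AT|exact: AS].
Qed.

Lemma reducedZ c T : A T -> A (fun x => c *: T x).
Proof. by move=> AT B [CB lB]; apply: (Cstar_scale CB); exact: AT. Qed.

Lemma reducedM T S : A T -> A S -> A (T \o S).
Proof.
by move=> AT AS B [CB lB]; apply: (Cstar_mul CB); [exact: AT|exact: AS].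
Qed.

Lemma reduced0 : A (fun=> 0).
Proof. by move=> B [CB lB]; exact: (Cstar_0 CB). Qed.

Lemma reduced_closed : norm_closed A.
Proof.
move=> T bT aT B [CB lB]; apply: (Cstar_closed CB) => // e e0.
by have [S AS TS] := aT e e0; exists S => //; exact: AS.
Qed.

Lemma reduced_bounded T : A T -> bounded_op T.
Proof. by move=> /reduced_approximable[]. Qed.

Lemma reduced_lsum s : A (lsum s).
Proof.
elim: s => [|p s IH].
  rewrite (_ : lsum _ = fun=> 0); first exact: reduced0.
  by apply/funext => x; rewrite lsum_nil.
rewrite (_ : lsum _ = (fun x => p.1 *: lam p.2 x) \+ lsum s).
  by apply: reducedD => //; apply: reducedZ; exact: reduced_lambda.
by apply/funext => x; rewrite lsum_cons.
Qed.

Lemma reduced_id : A (fun x => x).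
Proof.
rewrite (_ : (fun x => x) = lam 1%g); first exact: reduced_lambda.
by apply/funext => x; rewrite lambda1.
Qed.

Lemma reduced_lamV g : A (lamV sigma g).
Proof. by apply: reducedZ; exact: reduced_lambda. Qed.

Lemma reduced_neq0 : A <> [set (fun=> 0)].
Proof.
move=> A0; have := reduced_id; rewrite A0 /= => /(congr1 (fun T => T delta1)) d0.
by have := ell2_norm_delta R (1 : G)%g; rewrite d0 ell2_norm0 => /eqP; rewrite eq_sym oner_eq0.
Qed.

Lemma ideal_averaging I F T : closed_ideal A I -> averaging sigma F -> I T -> I (F T).
Proof.
move=> cI aF IT; elim: aF => {F} [//|F1 F2 _ h1 _ h2|g F _ h].
  exact: (ideal_scale cI (halfc R) (ideal_add cI h1 h2)).
apply: (ideal_mull cI (reduced_lambda g)).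
exact: (ideal_mulr cI h (reduced_lamV g)).
Qed.

Lemma ideal_with_id I : closed_ideal A I -> I (fun x => x) -> I = A.
Proof.
move=> cI I1; apply/seteqP; split; first exact: (ideal_sub cI).
by move=> T AT; exact: (ideal_mulr cI I1 AT).
Qed.

Lemma coef_adj_mul s :
  coef (lsum (mul_seq sigma (adj_seq sigma s) s)) 1%g =
  ell2_inner (lsum s delta1) (lsum s delta1).
Proof. by rewrite /coef -inner_delta -lsum_mul inner_lsum_adj. Qed.

(* For [T] in the ideal and a finite sum [s] close to [T], the average of
   [s^* T] is close to the scalar [tau (s^* s)]. *)
Lemma null_simple : (forall g, g != 1%g -> null sigma (lam g)) -> Cstar_simple sigma.
Proof.
move=> nullA; split; first exact: reduced_neq0.
move=> I cI; have [I0|] := pselect (forall T, I T -> T = fun=> 0).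
  left; apply/seteqP; split=> [T /I0//|_ ->]; exact: (ideal_0 cI).
move=> /existsNP[T0] /not_implyP[IT0 T0n0]; right; apply: ideal_with_id => //.
have [h T0h] : exists h, T0 (delta R h) != 0.
  apply: contrapT => H; apply: T0n0; apply/funext; apply: delta_dense.
    exact: (reduced_bounded (ideal_sub cI IT0)).
  by move=> g; apply/eqP/negP => /negP g0; apply: H; exists g.
(* The translation moves a nonzero value of [T0] to the vector at 1, on which coefficients are
   computed. *)
pose T := T0 \o lam h; have IT : I T := ideal_mulr cI IT0 (reduced_lambda h).
set r := ell2_norm (T delta1); have r0 : 0 < r.
  rewrite lt_def norm_pos andbT; apply: contra T0h => /eqP /ell2_norm_eq0.
  by rewrite /T /= lambda_delta1 => ->.
have [_ aT] := reduced_approximable (ideal_sub cI IT).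
have [_ [M M0 TM]] := bounded_opP (reduced_bounded (ideal_sub cI IT)).
apply: (norm_closedP (ideal_closed cI)); first exact: (reduced_bounded reduced_id).
move=> eps eps0; pose e' := eps * r ^+ 2 / 8.
have e'0 : 0 < e' by rewrite divr_gt0// mulr_gt0// exprn_gt0.
have M1 : 0 < M + 1 by rewrite ltr_wpDl.
(* The bound 1 gives |s| <= M + 1. The bound r / 2 gives |s delta_1| >= r / 2, hence |c| >= r^2 / 4.
   The last one makes the norm of s^* (T - s) at most e'. *)
pose e := Num.min (Num.min 1 (r / 2)) (e' / (M + 1)).
have e0 : 0 < e by rewrite /e !lt_min ltr01 (divr_gt0 r0)// (divr_gt0 e'0).
have [e1 er eM] : [/\ e <= 1, e <= r / 2 & e * (M + 1) <= e'].
  by rewrite -ler_pdivlMr// /e !ge_min !lexx ?orbT.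
have [s hs] := aT e e0; set s' := adj_seq sigma s.
have sM : bounded_by (lsum s) (M + 1).
  move=> x; rewrite (_ : lsum s x = T x - (T \- lsum s) x); last by rewrite /= subKr.
  apply: le_trans (ell2_norm_triangle _ _) _; rewrite ell2_normN mulrDl mul1r.
  by apply: lerD => //; apply: le_trans (hs x) _; rewrite ler_piMl.
have s'M : bounded_by (lsum s') (M + 1).
  by apply: bounded_by_adjoint sM => x y; rewrite inner_lsum.
pose w := mul_seq sigma s' s; set c := coef (lsum w) 1%g.
have cr : r ^+ 2 / 4 <= normc c.
  apply: (@le_trans _ _ (ell2_norm (lsum s delta1) ^+ 2)); last first.
    rewrite -inner_self /c coef_adj_mul; apply: le_trans (ler_norm _) _.
    exact: Re_le_normc.
  have : r <= ell2_norm (lsum s delta1) + e.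
    rewrite /r (_ : T delta1 = lsum s delta1 + (T \- lsum s) delta1); last first.
      by rewrite /= addrCA subrr addr0.
    apply: le_trans (ell2_norm_triangle _ _) _; rewrite lerD2l.
    by have := hs delta1; rewrite ell2_norm_delta mulr1.
  rewrite -lerBlDr => h'; have rh : r / 2 <= ell2_norm (lsum s delta1).
    by apply: le_trans h'; rewrite [X in X - _]splitr -addrA lerDl subr_ge0.
  rewrite (_ : r ^+ 2 / 4 = (r / 2) ^+ 2); last by field.
  by rewrite ler_sqr ?nnegrE// divr_ge0// ltW.
have c0 : 0 < normc c by apply: lt_le_trans cr; rewrite divr_gt0// exprn_gt0.
pose w' := [seq p <- w | p.2 != 1%g].
have nw : null sigma (lsum w').
  by apply: null_lsum => p; rewrite mem_filter => /andP[p1 _]; exact: nullA.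
have [F [aF hF]] := nw _ (averaging_id sigma) _ e'0.
pose U := lsum s' \o T.
have IU : I U := ideal_mull cI (reduced_lsum s') IT.
exists (fun x => c^-1 *: F U x).
  by apply: (ideal_scale cI); exact: (ideal_averaging cI aF IU).
(* s^* T = s^* s + s^* (T - s), and s^* s splits into its scalar part [c] and the null part [w']. *)
have UE : U = (fun x => c *: x + (lsum w' x + lsum s' (T x - lsum s x))).
  apply/funext => x; rewrite (linear_opB _ _ (lsum_linear sigma s')) lsum_mul.
  by rewrite -/w [lsum w]lsum_split1 -/w' -/c addrA addrC subrK.
have FE x : F U x = c *: x + (F (lsum w') x + F (fun x => lsum s' (T x - lsum s x)) x).
  by rewrite UE (averaging_linear _ _ _ aF) (averaging_id_op aF) (averagingD _ _ aF).
have cn0 : c != 0 by apply/eqP => c00; move: c0; rewrite c00 normc0 ltxx.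
move=> x /=; rewrite FE scalerDr scalerA mulVf// scale1r opprD addrA subrr add0r.
rewrite ell2_normN ell2_normZ normcV -ler_pdivlMl ?invr_gt0// invrK.
apply: le_trans (ell2_norm_triangle _ _) _.
have h2 : bounded_by (F (fun x => lsum s' (T x - lsum s x))) e'.
  apply: (averaging_bounded aF) => y; apply: le_trans (s'M _) _.
  apply: le_trans (ler_wpM2l (ltW M1) (hs y)) _.
  by rewrite mulrA ler_wpM2r// mulrC.
apply: le_trans (lerD (hF x) (h2 x)) _; rewrite -mulrDl mulrA ler_wpM2r//.
rewrite (_ : e' + e' = eps * (r ^+ 2 / 4)); last by rewrite /e'; field.
by rewrite mulrC ler_wpM2r// ltW.
Qed.

End ReducedAlgebra.

(** * Central elements of a simple reduced algebra *)

Section CentralElements.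
Variables (R : realType) (G : groupType) (sigma : two_cocycle R G).
Implicit Types (x y : ell2 R G) (c : R[i]) (T S : operator R G).
Implicit Types (s t : seq (R[i] * G)) (g h k : G).
Local Notation lam := (lambda sigma).
Local Notation lsum := (lsum sigma).
Local Notation adj := (adj_seq sigma).
Local Notation tw := (twist sigma).
Local Notation A := (reduced_algebra sigma).
Local Notation delta1 := (delta R (1 : G)%g).

Let normc_pos c : 0 <= normc c. Proof. exact: normc_ge0. Qed.
Let norm_pos x : 0 <= ell2_norm x. Proof. exact: ell2_norm_ge0. Qed.
Hint Resolve normc_pos norm_pos : core.

Definition central s := forall g x, lam g (lsum s x) = lsum s (lam g x).

Lemma central_lsum s t x : central s -> lsum t (lsum s x) = lsum s (lsum t x).
Proof.
move=> cs; elim: t => [|p t IH].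
  by rewrite !lsum_nil -[in RHS](scale0r x) lsumZ scale0r.
by rewrite !lsum_cons cs IH lsumD lsumZ.
Qed.

Lemma central_adj s : central s -> central (adj s).
Proof.
move=> cs g x; apply: inner_ext => y.
rewrite inner_lamV !inner_lsum_adj inner_lamV; congr ell2_inner.
by apply: (can_inj (lamK sigma g)); rewrite lamVK cs lamVK.
Qed.

(** Both sides are norm continuous in [T] and agree when [T] is a finite sum. *)
Lemma central_reduced s T x : central s -> A T -> T (lsum s x) = lsum s (T x).
Proof.
move=> cs AT; have [bT aT] := reduced_approximable AT.
apply/eqP; rewrite -subr_eq0; apply/eqP.
apply: (@bounded_by_eq0 R G (fun x => T (lsum s x) - lsum s (T x))) => e e0 {}x.
have s1 : 0 < 2 * (ell1 s + 1) by rewrite mulr_gt0// ltr_wpDl// ell1_ge0.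
have [t ht] := aT _ (divr_gt0 e0 s1).
rewrite (_ : _ - _ = (T \- lsum t) (lsum s x) - lsum s ((T \- lsum t) x)); last first.
  rewrite /= (linear_opB _ _ (lsum_linear sigma s)) (central_lsum _ _ cs).
  by rewrite opprB addrA subrK.
apply: le_trans (ell2_norm_triangle _ _) _; rewrite ell2_normN.
apply: le_trans (lerD (ht _) (lsum_bounded sigma s _)) _.
apply: le_trans (lerD (ler_wpM2l _ (lsum_bounded sigma s x))
  (ler_wpM2l (ell1_ge0 s) (ht x))) _; first by rewrite divr_ge0 ?ltW.
rewrite (_ : _ + _ = e * ((2 * ell1 s) / (2 * (ell1 s + 1))) * ell2_norm x).
  apply: ler_wpM2r => //; rewrite ler_piMr ?(ltW e0)//.
  by rewrite ler_pdivrMr// mul1r ler_pM2l// lerDl.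
by move: (2 * (ell1 s + 1))^-1 => p; ring.
Qed.

(** Expand the square and use |s^* s x| <= M |s x|. Vectors on which [s] almost attains its norm are
    thus almost annihilated by M^2 - s^* s. *)
Lemma lsum_adj_lsum_norm s (M : R) x : 0 <= M -> bounded_by (lsum s) M ->
  ell2_norm ((M ^+ 2)%:C%C *: x - lsum (adj s) (lsum s x)) ^+ 2 <=
  M ^+ 2 * (M ^+ 2 * ell2_norm x ^+ 2 - ell2_norm (lsum s x) ^+ 2).
Proof.
move=> M0 sM; set y := lsum _ (lsum s x).
have aM : bounded_by (lsum (adj s)) M.
  by apply: bounded_by_adjoint sM => u v; rewrite inner_lsum.
have yM : ell2_norm y ^+ 2 <= M ^+ 2 * ell2_norm (lsum s x) ^+ 2.
  by rewrite -exprMn ler_sqr ?nnegrE ?mulr_ge0//; exact: aM.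
rewrite (ell2_normB_sq _ (- y)) ell2_normN ell2_normZ normc_real ?exprn_ge0//.
rewrite innerZl (_ : complex.Re _ = - (M ^+ 2 * ell2_norm (lsum s x) ^+ 2)); last first.
  rewrite -inner_self /y -(scaleN1r (lsum (adj s) _)) innerZr -inner_lsum.
  by case: (ell2_inner _ _) => p q; rewrite !ReMc !ImMc /=; ring.
rewrite exprMn; move: yM; move: (ell2_norm y ^+ 2) (ell2_norm (lsum s x) ^+ 2) (ell2_norm x ^+ 2).
by move: (M ^+ 2) => m p q r; nra.
Qed.

Let half_contra (p q : R) : 2^-1 <= q -> p <= 8^-1 -> q <= 4^-1 * q + p -> False.
Proof. by move=> *; lra. Qed.

(* [M^2 - s^* s] with [M] the norm of [s] is not bounded below, so the closed
   ideal generated by this central element is proper, hence zero. *)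
Lemma central_norm_scalar s : Cstar_simple sigma -> central s ->
  exists c, forall x, lsum (adj s) (lsum s x) = c *: x.
Proof.
move=> [_ simpleA] cs; have bs := lsum_bounded_op sigma s.
set M := op_norm (lsum s); have sM : bounded_by (lsum s) M by exact: op_normP.
have M0 : 0 <= M.
  by have := sM delta1; rewrite ell2_norm_delta mulr1; apply: le_trans.
pose w := ((M ^+ 2)%:C%C, 1%g) :: lscale (-1) (mul_seq sigma (adj s) s).
have wE x : lsum w x = (M ^+ 2)%:C%C *: x - lsum (adj s) (lsum s x).
  by rewrite /w lsum_cons lambda1 lsum_scale -lsum_mul scaleN1r.
have cw : central w.
  move=> g x; have lg : linear (lam g) by rewrite lambda_lsum; exact: lsum_linear.
  by rewrite !wE (linear_opB _ _ lg) lambdaZ (central_adj cs) cs.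
exists (M ^+ 2)%:C%C => x0.
have [M00|Mn0] := eqVneq M 0.
  have Z0 x : lsum s x = 0.
    apply: ell2_norm_eq0; apply/eqP; rewrite eq_le norm_pos andbT.
    by have := sM x; rewrite M00 mul0r.
  rewrite Z0 M00 expr0n /= (_ : 0%:C%C = 0 :> R[i])// scale0r.
  exact: linear_op0 (lsum_linear sigma _).
have Mp : 0 < M by rewrite lt_def Mn0 M0.
have small (e : R) : 0 < e -> exists x, 2^-1 <= ell2_norm x /\ ell2_norm (lsum w x) <= e.
  (* A vector with |x| <= 1 and |s x| >= M - d satisfies |w x|^2 <= M^2 (M^2 - (M - d)^2) <= 2 M^3 d
     <= e^2. *)
  move=> e0; pose d := Num.min (M / 2) (e ^+ 2 / (2 * M ^+ 3)).
  have M30 : 0 < 2 * M ^+ 3 by rewrite mulr_gt0// exprn_gt0.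
  have d0 : 0 < d by rewrite /d lt_min !divr_gt0 ?exprn_gt0.
  have [dM de] : d <= M / 2 /\ d * (2 * M ^+ 3) <= e ^+ 2.
    by rewrite -ler_pdivlMr// /d !ge_min !lexx ?orbT.
  have [_ [x /= x1 <-] hx] := sup_adherent d0 (op_norm_has_sup bs).
  rewrite -/(op_norm _) -/M in hx; exists x; split.
    have : M / 2 <= M * ell2_norm x.
      by apply: le_trans (sM x); apply/ltW; apply: le_lt_trans hx; lra.
    by rewrite ler_pM2l.
  rewrite -ler_sqr ?nnegrE ?(ltW e0)// wE.
  apply: le_trans (lsum_adj_lsum_norm x M0 sM) _.
  have x2 : ell2_norm x ^+ 2 <= 1 by rewrite expr_le1.
  have sx2 : (M - d) ^+ 2 <= ell2_norm (lsum s x) ^+ 2.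
    by rewrite ler_sqr ?nnegrE//; [apply: ltW|lra].
  apply: (le_trans _ de).
  rewrite (_ : d * _ = M ^+ 2 * (2 * M * d)); last by ring.
  apply: ler_wpM2l; first exact: exprn_ge0.
  have : M ^+ 2 * ell2_norm x ^+ 2 <= M ^+ 2 by rewrite ler_piMr// exprn_ge0.
  have := sqr_ge0 d; move: sx2.
  move: (ell2_norm (lsum s x) ^+ 2) (M ^+ 2 * _) => p q; rewrite sqrrB; lra.
(* The norm closure of w A; it is a two-sided ideal since [w] commutes with all of [A]. *)
pose I := [set T | A T /\ forall e : R, 0 < e ->
  exists2 S, A S & bounded_by (fun x => T x - lsum w (S x)) e].
have lw := lsum_linear sigma w.
have cI : closed_ideal A I.
  split.
  - by move=> T [].
  - split; first exact: reduced0.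
    move=> e e0; exists (fun=> 0); first exact: reduced0.
    by move=> x; rewrite (linear_op0 lw) subrr ell2_norm0 mulr_ge0// ltW.
  - move=> S T [AS aS] [AT aT]; split; first exact: reducedD.
    move=> e e0; have e2 : 0 < e / 2 by rewrite divr_gt0.
    have [S' AS' hS] := aS _ e2; have [T' AT' hT] := aT _ e2.
    exists (S' \+ T'); first exact: reducedD.
    move=> x; rewrite /= (linear_opD _ _ lw) opprD addrACA.
    apply: le_trans (ell2_norm_triangle _ _) _.
    by apply: le_trans (lerD (hS x) (hT x)) _; rewrite -mulrDl -splitr.
  - move=> c T [AT aT]; split; first exact: reducedZ.
    move=> e e0; have c1 : 0 < normc c + 1 by rewrite ltr_wpDl.
    have [S AS hS] := aT _ (divr_gt0 e0 c1).
    exists (fun x => c *: S x); first exact: reducedZ.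
    move=> x; rewrite (linear_opZ _ _ lw) -scalerBr ell2_normZ.
    apply: le_trans (ler_wpM2l (normc_pos _) (hS x)) _; rewrite mulrA ler_wpM2r//.
    rewrite mulrCA ler_piMr ?(ltW e0)//.
    by rewrite ler_pdivrMr// mul1r lerDl.
  - move=> S T AS [AT aT]; split; first exact: reducedM.
    have [lS [K K0 SK]] := bounded_opP (reduced_bounded AS).
    move=> e e0; have K1 : 0 < K + 1 by rewrite ltr_wpDl.
    have [T' AT' hT] := aT _ (divr_gt0 e0 K1).
    exists (S \o T'); first exact: reducedM.
    move=> x /=; rewrite -(central_reduced _ cw AS) -(linear_opB _ _ lS).
    apply: le_trans (SK _) _; apply: le_trans (ler_wpM2l K0 (hT x)) _.
    rewrite mulrA ler_wpM2r// mulrCA ler_piMr ?(ltW e0)//.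
    by rewrite ler_pdivrMr// mul1r lerDl.
  - move=> S T [AS aS] AT; split; first exact: reducedM.
    have [lT [K K0 TK]] := bounded_opP (reduced_bounded AT).
    move=> e e0; have K1 : 0 < K + 1 by rewrite ltr_wpDl.
    have [S' AS' hS] := aS _ (divr_gt0 e0 K1).
    exists (S' \o T); first exact: reducedM.
    move=> x /=; apply: le_trans (hS _) _.
    apply: le_trans (ler_wpM2l _ (TK x)) _; first by rewrite divr_ge0// ltW.
    rewrite mulrA ler_wpM2r// mulrAC -mulrA ler_piMr ?(ltW e0)//.
    by rewrite ler_pdivrMr// mul1r lerDl.
  - move=> T bT aT; split.
      by apply: reduced_closed => // e e0; have [S [AS _] TS] := aT e e0; exists S.
    move=> e e0; have e2 : 0 < e / 2 by rewrite divr_gt0.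
    have [S [AS aS] TS] := aT _ e2; have [S' AS' hS] := aS _ e2; exists S' => // x.
    rewrite (_ : _ - _ = (T \- S) x + (S x - lsum w (S' x))); last by rewrite /= addrA subrK.
    apply: le_trans (ell2_norm_triangle _ _) _.
    apply: le_trans (lerD (op_normP (bounded_opB bT (reduced_bounded AS)) x) (hS x)) _.
    rewrite -mulrDl ler_wpM2r// [leRHS]splitr lerD2r; exact: ltW.
have Iw : I (lsum w).
  split; first exact: reduced_lsum.
  move=> e e0; exists (fun x => x); first exact: reduced_id.
  by move=> x; rewrite subrr ell2_norm0 mulr_ge0// ltW.
have [I0|IA] := simpleA I cI.
  have : lsum w = fun=> 0 by move: Iw; rewrite I0.
  by move=> /(congr1 (fun T => T x0)); rewrite wE => /eqP; rewrite subr_eq0 => /eqP ->.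
(* If the identity lies in the ideal, some w S is within 1/4 of it. A vector with |x| >= 1/2 and w x
   tiny then satisfies |x| <= |x|/4 + 1/8, which is absurd. *)
have [_ aid] : I (fun x => x) by rewrite IA; exact: reduced_id.
have e4 : 0 < 4^-1 :> R by rewrite invr_gt0.
have [S AS hS] := aid _ e4.
have [lS [K K0 SK]] := bounded_opP (reduced_bounded AS).
have K1 : 0 < 8 * (K + 1) by rewrite mulr_gt0// ltr_wpDl.
have [x [x2 wx]] := small _ (divr_gt0 ltr01 K1).
have : ell2_norm x <= 4^-1 * ell2_norm x + K * (1 / (8 * (K + 1))).
  have {1}-> : x = (x - lsum w (S x)) + S (lsum w x).
    by rewrite (central_reduced _ cw AS) subrK.
  apply: le_trans (ell2_norm_triangle _ _) _; apply: lerD; first exact: hS.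
  by apply: le_trans (SK _) _; apply: ler_wpM2l.
have : K * (1 / (8 * (K + 1))) <= 8^-1.
  rewrite mulrA mulr1 ler_pdivrMr// mulrA mulVf ?pnatr_eq0// mul1r lerDl; exact: ler01.
by move=> h1 h2; case: (half_contra x2 h1 h2).
Qed.

End CentralElements.

(** * From simplicity to Kleppner's condition *)

Section SimpleKleppner.
Variables (R : realType) (G : groupType) (sigma : two_cocycle R G).
Local Notation lam := (lambda sigma).
Local Notation lsum := (lsum sigma).
Local Notation adj := (adj_seq sigma).
Local Notation tw := (twist sigma).
Local Notation central := (central sigma).
Local Notation delta1 := (delta R (1 : G)%g).

Lemma simple_kleppner : Cstar_simple sigma -> kleppner sigma.
Proof.
move=> simple k k1 fin; apply: contrapT => nh.
have tw1 h : commute k h -> tw h k = 1.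
  move=> ch; apply/eqP/negP => /negP th; apply: nh; by exists h.
(* As [k] violates the condition, [tw g k] depends only on the conjugate of [k] by g^-1. This makes
   the coefficients [d] on the class of [k] well defined. *)
have twE g g' : (k ^ g^-1)%g = (k ^ g'^-1)%g -> tw g k = tw g' k.
  move=> gg'; have cgg : commute k (g^-1 * g')%g.
    by apply: conjg_commute; rewrite conjgM gg' conjgKV.
  have -> : g' = (g * (g^-1 * g'))%g by rewrite mulVKg.
  by rewrite (twistM sigma g) (commute_conjgV cgg) (tw1 _ cgg) mulr1.
pose gy (y : G) := xget 1%g [set g | (k ^ g^-1)%g = y].
pose d (y : G) := tw (gy y) k.
have dE g : d (k ^ g^-1)%g = tw g k.
  by apply: twE; apply: (@xgetPex _ 1%g [set g' | (k ^ g'^-1)%g = (k ^ g^-1)%g]); exists g.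
pose X := finmap.enum_fset (fset_set (conj_class k)).
have XE (y : G) : y \in X = (y \in conj_class k) by rewrite -in_fset_set.
have uX : uniq X by exact: finmap.fset_uniq.
(* By [twistM], every Ad(g) permutes the terms of this weighted sum over the class, so the sum is
   central. *)
pose z : seq (R[i] * G) := [seq (d y, y) | y <- X].
have cz : central z.
  move=> g x; rewrite -{1}(lamK sigma g x) -[LHS]/(Ad sigma g (lsum z) (lam g x)).
  rewrite Ad_lsum; move: (lam g x) => {}x.
  rewrite !lsumE /z /conj_seq -map_comp !big_map.
  have pX : perm_eq X [seq (y ^ g^-1)%g | y <- X].
    apply: uniq_perm => //; first by rewrite map_inj_uniq//; exact: conjg_inj.
    move=> y; rewrite XE; apply/idP/mapP => [|[y' + ->]].
      move=> /set_mem[l _ <-]; exists (k ^ (l * g))%g; last by rewrite conjgM conjgK.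
      by rewrite XE; apply/mem_set; exists (l * g)%g.
    rewrite XE => /set_mem[l _ <-]; apply/mem_set; exists (l * g^-1)%g => //.
    by rewrite conjgM.
  rewrite [RHS](perm_big _ pX) big_map big_seq [RHS]big_seq; apply: eq_bigr => y.
  rewrite XE => /set_mem[l _ ly] /=; congr (_ *: _).
  have ly' : y = (k ^ l^-1^-1)%g by rewrite invgK.
  have -> : (y ^ g^-1 = k ^ (g * l^-1)^-1)%g by rewrite invgM conjgM -ly'.
  by rewrite dE twistM -ly' {1}ly' dE mulrC.
pose zt (c : R[i]) := (c, 1%g) :: z.
have czt c : central (zt c).
  by move=> g x; rewrite !lsum_cons !lambda1 lambdaD lambdaZ cz.
pose q := coef (lsum z) k; pose r := coef (lsum (adj z)) k.
pose p := coef (fun x => lsum (adj z) (lsum z x)) k.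
have adjE c x : lsum (adj (zt c)) x = conjc c *: x + lsum (adj z) x.
  by rewrite /zt /= lsum_cons /= invg1 cocycle_1g invr1 mulr1 lambda1.
(* The coefficient at [k] of (z + c)^* (z + c) vanishes, because this product is a scalar and [k] is
   not 1. The values c = 0, 1, i then give p = 0, r = -q and -2iq = 0. *)
have key c : conjc c * q + c * r + p = 0.
  have [e ec] := central_norm_scalar simple (czt c).
  have := congr1 (fun v : ell2 R G => v k) (ec delta1).
  rewrite adjE !lsum_cons !lambda1 lsumD lsumZ !(ell2D, ell2Z) deltaE (negbTE k1) mulr0 mulr0 add0r.
  by rewrite -!/(coef _ k) addrA -[RHS](mulr0 e).
have qn0 : q != 0.
  have kX : k \in X by rewrite XE; apply/mem_set; exists 1%g; rewrite ?conjg1.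
  rewrite /q coef_lsum big_map big_mkcond/= (bigD1_seq k)//= eqxx big1 ?addr0 => [|y].
    exact: twist_neq0.
  by move=> /negbTE ->.
have p0 : p = 0 by have := key 0; rewrite conjc0 !mul0r !add0r.
have rq : r = - q.
  by have := key 1; rewrite conjc1 !mul1r p0 addr0 addrC => /eqP; rewrite addr_eq0 => /eqP.
have := key (Complex 0 1); rewrite p0 addr0 rq mulrN -mulrBl => /eqP.
rewrite mulf_eq0 (negbTE qn0) orbF eq_complex /= => /andP[_].
by rewrite -opprD oppr_eq0 -mulr2n pnatr_eq0.
Qed.

End SimpleKleppner.

Lemma finite_uniq_seq (T : choiceType) (A : set T) : finite_set A ->
  exists2 s : seq T, uniq s & forall x, x \in s <-> A x.
Proof.
move=> fin; exists (finmap.enum_fset (fset_set A)); first exact: finmap.fset_uniq.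
move=> x; have <- : (x \in A) = (x \in finmap.enum_fset (fset_set A)).
  by rewrite -in_fset_set.
by split=> [/set_mem|/mem_set].
Qed.

Section MultiplicativeMaps.
Local Open Scope group_scope.
Variables (G K : groupType) (f : {multiplicative G -> K}).

Lemma multiplicative1 : f 1 = 1.
Proof. by apply: (mulgI (f 1)); rewrite -gmulfM !mulg1. Qed.

Lemma multiplicativeV x : f x^-1 = (f x)^-1.
Proof. by apply/esym/mulg1_eq; rewrite -gmulfM mulgV multiplicative1. Qed.

Lemma multiplicativeJ x y : f (x ^ y) = f x ^ f y.
Proof. by rewrite !conjgE !gmulfM multiplicativeV. Qed.

End MultiplicativeMaps.

(** * The upper FC-series *)

Section Cosets.
Local Open Scope group_scope.
Variables (G : groupType) (N : set G) (nN : normal_set N).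
Implicit Types x y z : G.

Let rel_trans x y z : N (x^-1 * y) -> N (y^-1 * z) -> N (x^-1 * z).
Proof. by move=> h h'; have := normal_setM nN h h'; rewrite -mulgA mulVKg. Qed.

Let rel_sym x y : N (x^-1 * y) -> N (y^-1 * x).
Proof. by move=> /(normal_setV nN); rewrite invgM invgK. Qed.

Lemma normal_set_relM x x' y y' : N (x^-1 * x') -> N (y^-1 * y') ->
  N ((x * y)^-1 * (x' * y')).
Proof.
move=> /(normal_setJ nN y) h h'; have := normal_setM nN h h'.
by rewrite conjgE invgM -!mulgA mulVKg.
Qed.

Lemma normal_set_relV x x' : N (x^-1 * x') -> N (x^-1^-1 * x'^-1).
Proof.
move=> /rel_sym /(normal_setJ nN x'^-1).
by rewrite conjgE !invgK !mulgA mulgV mul1g.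
Qed.

(** Congruent elements define the same set of candidates, so [xget] returns the same representative
    for both. *)
Definition coset_repr x : G := xget 1 [set y | N (x^-1 * y)].

Lemma coset_reprP x : N (x^-1 * coset_repr x).
Proof.
apply: (@xgetPex _ 1 [set y | N (x^-1 * y)]); exists x.
by rewrite /= mulVg; exact: normal_set1.
Qed.

Lemma coset_repr_eq x y : coset_repr x = coset_repr y <-> N (x^-1 * y).
Proof.
split=> [e|xy].
  by apply: (rel_trans (coset_reprP x)); rewrite e; apply: rel_sym; exact: coset_reprP.
rewrite /coset_repr; congr (xget 1 _); apply/seteqP; split=> z /= h.
  exact: rel_trans (rel_sym xy) h.
exact: rel_trans xy h.
Qed.

Lemma coset_repr_id x : coset_repr (coset_repr x) = coset_repr x.
Proof. by apply/coset_repr_eq; apply: rel_sym; exact: coset_reprP. Qed.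

End Cosets.

(** * The quotient by a normal subgroup *)

Section QuotientGroup.
Local Open Scope group_scope.
Variables (G : groupType) (N : set G).

(** The quotient lives on the fixed points of [coset_repr], so that its choice structure comes from
    [G]. An actual group is required because [FC_hypercentral] quantifies over homomorphic
    images. *)
Record quotient_group (nN : normal_set N) := QuotientElt {
  quotient_val : G;
  quotient_valP : coset_repr N quotient_val == quotient_val }.

Variable nN : normal_set N.

HB.instance Definition _ := [isSub for @quotient_val nN].
HB.instance Definition _ := [Choice of quotient_group nN by <:].

Fact coset_subproof x : coset_repr N (coset_repr N x) == coset_repr N x.
Proof. by rewrite (coset_repr_id nN). Qed.

Definition coset x : quotient_group nN := QuotientElt nN (coset_subproof x).

Lemma coset_eq x y : coset x = coset y <-> N (x^-1 * y).
Proof.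
split=> [/(congr1 (@quotient_val nN))/(coset_repr_eq nN)|/(coset_repr_eq nN) h]; first exact.
by apply: val_inj; exact: h.
Qed.

Lemma coset_val (a : quotient_group nN) : coset (quotient_val a) = a.
Proof. by apply: val_inj; apply/eqP; exact: quotient_valP. Qed.

Let qmul (a b : quotient_group nN) := coset (quotient_val a * quotient_val b).
Let qinv (a : quotient_group nN) := coset (quotient_val a)^-1.

Let coset_mul x y : qmul (coset x) (coset y) = coset (x * y).
Proof.
apply/esym/coset_eq; apply: normal_set_relM => //; exact: coset_reprP.
Qed.

Let coset_inv x : qinv (coset x) = coset x^-1.
Proof. by apply/esym/coset_eq; apply: normal_set_relV => //; exact: coset_reprP. Qed.

Let qmulA : associative qmul.
Proof.
by move=> a b c; rewrite -(coset_val a) -(coset_val b) -(coset_val c) !coset_mul mulgA.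
Qed.

Let qmul1g : left_id (coset 1) qmul.
Proof. by move=> a; rewrite -(coset_val a) coset_mul mul1g. Qed.

Let qmulg1 : right_id (coset 1) qmul.
Proof. by move=> a; rewrite -(coset_val a) coset_mul mulg1. Qed.

Let qmulVg : left_inverse (coset 1) qinv qmul.
Proof. by move=> a; rewrite -(coset_val a) coset_inv coset_mul mulVg. Qed.

Let qmulgV : right_inverse (coset 1) qinv qmul.
Proof. by move=> a; rewrite -(coset_val a) coset_inv coset_mul mulgV. Qed.

HB.instance Definition _ :=
  isGroup.Build (quotient_group nN) qmulA qmul1g qmulg1 qmulVg qmulgV.

Lemma cosetM : {morph coset : x y / x * y}.
Proof. by move=> x y; rewrite -coset_mul. Qed.

HB.instance Definition _ := isMultiplicative.Build G (quotient_group nN) coset cosetM.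

End QuotientGroup.
Arguments coset {G N} nN x.
Arguments coset_eq {G N} nN x y.
Arguments coset_val {G N nN} a.

(** * Induction along the upper FC-series; subgroups of FC-hypercentral groups *)

Section FCInduction.
Local Open Scope group_scope.
Variable G : groupType.
Implicit Types x y g : G.

(** This set is the preimage of the FC-center of the quotient by [N], that is, the successor of [N]
    in the upper FC-series. *)
Lemma finite_class_mod_normal (N : set G) :
  normal_set N -> normal_set (finite_class_mod N).
Proof.
move=> nN; split.
- exists [:: 1] => g; exists 1; first by rewrite mem_head.
  by rewrite invg1 mul1g conj1g; exact: normal_set1.
- move=> x y [X Xx] [Y Yy]; exists [seq a * b | a <- X, b <- Y] => g.
  have [a aX ha] := Xx g; have [b bY hb] := Yy g.
  exists (a * b); first by apply/allpairsP; exists (a, b).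
  by rewrite conjMg; exact: normal_set_relM.
- move=> x [X Xx]; exists [seq a^-1 | a <- X] => g; have [a aX ha] := Xx g.
  exists a^-1; first by rewrite map_f.
  by rewrite conjVg; exact: normal_set_relV.
- move=> x h [X Xx]; exists X => g; have [a aX ha] := Xx (h * g).
  by exists a; rewrite // -conjgM.
Qed.

(** [F i] is determined by the coset of [x ^ e i], and only finitely many cosets occur. The map [e]
    allows conjugators from [G] or from a subgroup. *)
Lemma finite_range_class_mod (N : set G) x (I : Type) (T : choiceType)
    (e : I -> G) (F : I -> T) : normal_set N ->
  finite_class_mod N x ->
  (forall i j, N ((x ^ e i)^-1 * x ^ e j) -> F i = F j) -> finite_set (range F).
Proof.
move=> nN [Y Yx] FN.
have [[i0 _]|nI] := pselect (exists i : I, True); last first.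
  by rewrite (_ : range F = set0)//; apply/seteqP; split=> // y [i _ _]; case: nI; exists i.
pose phi y := xget (F i0) [set F i | i in [set i | N (y^-1 * x ^ e i)]].
have fY : finite_set [set phi y | y in [set` Y]] by exact/finite_image/finite_seq.
apply: sub_finite_set fY.
move=> _ [i _ <-]; have [y yY hy] := Yx (e i); exists y => //.
have : [set F i | i in [set i | N (y^-1 * x ^ e i)]] (phi y).
  by apply: xgetPex; exists (F i), i.
by move=> [j hj <-]; apply: FN; exact: normal_set_div hj hy.
Qed.

(** Zorn's lemma replaces ordinals: take [N] maximal among the normal subgroups on which [Q] holds.
    By maximality the quotient by [N] has trivial FC-center, so it is icc, hence trivial. *)
Lemma FC_ind (Q : G -> Prop) : FC_hypercentral G -> Q 1 ->
  (forall N, normal_set N -> (forall x, N x -> Q x) ->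
     forall x, finite_class_mod N x -> Q x) ->
  forall x, Q x.
Proof.
move=> FCG Q1 Qstep.
pose P : set (set G) := [set N | N = set0 \/ (normal_set N /\ forall x, N x -> Q x)].
have [F FP totF|N [PN Nmax]] := @Zorn_bigcup _ P.
  have [[X [FX X0]]|nF] := pselect (exists X, F X /\ X !=set0); last first.
    left; apply/seteqP; split=> // x [X FX Xx]; apply: nF; exists X; split=> //; by exists x.
  right; have nX Y y : F Y -> Y y -> normal_set Y /\ forall x, Y x -> Q x.
    by move=> FY Yy; have [Y0|//] := FP Y FY; rewrite Y0 in Yy.
  split; last by move=> x [Y FY Yx]; apply: (nX Y x FY Yx).2.
  have [x0 Xx0] := X0; split.
  - by exists X => //; apply: normal_set1; exact: (nX X x0 FX Xx0).1.
  - move=> x y [Y FY Yx] [Z FZ Zy].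
    have [YZ|ZY] := totF _ _ FY FZ.
      by exists Z => //; apply: (normal_setM (nX Z y FZ Zy).1) => //; exact: YZ.
    by exists Y => //; apply: (normal_setM (nX Y x FY Yx).1) => //; exact: ZY.
  - by move=> x [Y FY Yx]; exists Y => //; apply: (normal_setV (nX Y x FY Yx).1).
  - by move=> x g [Y FY Yx]; exists Y => //; apply: (normal_setJ (nX Y x FY Yx).1).
have {PN}[nN NQ] : normal_set N /\ forall x, N x -> Q x.
  case: PN => // N0; exfalso; apply: (Nmax [set 1]).
    by rewrite N0; split=> [//|/(_ 1 erefl)].
  right; split=> [|x ->//]; split=> //=.
  - by move=> x y -> ->; rewrite mulg1.
  - by move=> x ->; rewrite invg1.
  - by move=> x g ->; rewrite conj1g.
have NM : finite_class_mod N `<=` N.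
  apply: contrapT => h; apply: (Nmax (finite_class_mod N)).
    split=> // x Nx; exists [:: 1] => g; exists 1; first by rewrite mem_head.
    by rewrite invg1 mul1g; exact: normal_setJ.
  by right; split; [exact: finite_class_mod_normal|exact: Qstep].
have iccQ : icc (quotient_group nN).
  move=> a a1 fin; apply: (negP a1); apply/eqP; rewrite -(coset_val a).
  apply/esym/(coset_eq nN); rewrite invg1 mul1g; apply: NM.
  have [S _ SE] := finite_uniq_seq fin.
  exists [seq quotient_val b | b <- S] => g.
  have bE : coset nN (quotient_val a ^ g) = a ^ coset nN g.
    by rewrite multiplicativeJ/= coset_val.
  exists (quotient_val (coset nN (quotient_val a ^ g))).
    by rewrite map_f//; apply/SE; rewrite bE; exists (coset nN g).
  by apply/(coset_eq nN); exact: coset_val.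
move=> x; apply: NQ.
have surj : forall y : quotient_group nN, exists x, coset nN x = y.
  by move=> y; exists (quotient_val y); exact: coset_val.
have := FCG _ (coset nN : {multiplicative G -> quotient_group nN}) surj iccQ (coset nN x).
by move=> /esym /(coset_eq nN); rewrite invg1 mul1g.
Qed.

(** [FC_ind] is applied in [G] to the property that [f] kills [x] if [x] is in [H]. If [f] kills all
    of [N] inside [H] and [x] has a finite class modulo [N], then the image of [x] has a finite
    class in the icc group, hence is 1. *)
Lemma FC_hypercentral_sub (H : groupClosed G) :
  FC_hypercentral G -> FC_hypercentral (subgrp H).
Proof.
move=> FCG Q f surj iccQ q.
suff fx : forall x (Hx : x \in H), f (SubGrp Hx) = 1.
  by have [[x Hx] <-] := surj q; exact: fx.
apply: FC_ind => // [H1|N nN fN x xN Hx].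
  by rewrite (_ : SubGrp H1 = 1) ?multiplicative1//; exact: val_inj.
apply/eqP; apply/negP => /negP /iccQ; apply.
have [K|] := pselect (finite_set (range (fun k : subgrp H => f (SubGrp Hx ^ k)))).
  apply: sub_finite_set K => _ [q' _ <-]; have [k <-] := surj q'.
  by exists k; rewrite // multiplicativeJ.
case; apply: (finite_range_class_mod (e := val) nN xN) => i j h.
have Hh : (x ^ val i)^-1 * x ^ val j \in H.
  by rewrite gpredM// ?gpredV gpredJ// subgrp_valP.
have := fN _ h Hh.
have -> : SubGrp Hh = (SubGrp Hx ^ i)^-1 * (SubGrp Hx ^ j) by apply: val_inj.
by rewrite gmulfM multiplicativeV => /mulg1_eq /esym; rewrite invgK.
Qed.

End FCInduction.

(** * From Kleppner's condition to simplicity *)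

Section FCHypercentralSimple.
Variables (R : realType) (G : groupType) (sigma : two_cocycle R G).

Lemma kleppner_simple : FC_hypercentral G -> kleppner sigma -> Cstar_simple sigma.
Proof.
move=> FCG K; apply: null_simple.
apply: (@FC_ind G (fun x => x != 1%g -> null sigma (lambda sigma x))) => //.
  by rewrite eqxx.
move=> N nN nullN x finx x1; apply: (null_step nN) => //.
by have [/(K x x1)|] := pselect (finite_set (conj_class x)); [right|left].
Qed.

End FCHypercentralSimple.

(** * Torsion elements with finite conjugacy classes *)

Section Words.
Local Open Scope group_scope.
Variable G : groupType.
Implicit Types (x y z : G) (s t : seq G) (X : seq G).

Definition word_prod s : G := foldr (fun x y => x * y) 1 s.

Lemma word_prod_cat s t : word_prod (s ++ t) = word_prod s * word_prod t.
Proof. by elim: s => [|x s IH] /=; rewrite ?mul1g// IH mulgA. Qed.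

Lemma word_prodJ s g : word_prod [seq x ^ g | x <- s] = word_prod s ^ g.
Proof. by elim: s => [|x s IH] /=; rewrite ?conj1g// IH conjMg. Qed.

(** An occurrence of [y] moves to the front by s y = y s^y; this conjugates the letters it passes
    and leaves the number of other occurrences of [y] unchanged. *)
Lemma word_prod_pull y m s X : (forall x, x \in X -> x ^ y \in X) ->
  (forall x, x \in s -> x \in X) -> (m <= count_mem y s)%N ->
  exists t, [/\ word_prod s = y ^+ m * word_prod t, (size t + m = size s)%N &
    forall z, z \in t -> z \in X].
Proof.
move=> XJ; elim: m s => [|m IH] s sX ms; first by exists s; rewrite mul1g addn0.
have ys : y \in s by rewrite -has_pred1 has_count (leq_trans _ ms).
case/splitPr: ys ms sX => s1 s2; rewrite count_cat /= eqxx => ms sX.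
have [||t [te tsz tX]] := IH ([seq x ^ y | x <- s1] ++ s2).
- move=> x; rewrite mem_cat => /orP[/mapP[z zs ->]|xs].
    by apply: XJ; apply: sX; rewrite mem_cat zs.
  by apply: sX; rewrite mem_cat inE xs !orbT.
- rewrite count_cat count_map (eq_count (a2 := pred1 y)); first by move: ms; rewrite addnCA.
  move=> x /=; rewrite -[in RHS](inj_eq (@conjg_inj _ y)).
  by rewrite [in RHS](_ : y ^ y = y)// conjgE mulKg.
exists t; split=> //.
  rewrite word_prod_cat /= expgS -mulgA -te word_prod_cat word_prodJ.
  by rewrite [LHS]mulgA [RHS]mulgA -conjgC.
by rewrite addnS tsz !size_cat size_map /= addnS.
Qed.

Lemma pigeonhole_count X s n : (forall x, x \in s -> x \in X) ->
  (size X * n < size s)%N -> exists2 y, y \in X & (n < count_mem y s)%N.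
Proof.
elim: X s => [|x X IH] s sX hs.
  by case: s sX hs => // y s /(_ y); rewrite mem_head => /(_ isT).
have [h|h] := ltnP n (count_mem x s); first by exists x; rewrite ?mem_head.
have [||y yX hy] := IH [seq y <- s | y != x].
- move=> y; rewrite mem_filter => /andP[yx /sX].
  by rewrite inE (negbTE yx).
- have e : (count_mem x s + count (fun y => y != x) s = size s)%N by exact: count_predC.
  rewrite size_filter; move: hs h; rewrite -e /= mulSn.
  by move: (count_mem x s) (count _ s) => a b; lia.
exists y; first by rewrite inE yX orbT.
apply: leq_trans hy _; rewrite count_filter; apply: sub_count => z /=.
by case/andP.
Qed.

Fixpoint word_ball X n : set G :=
  if n is m.+1 then [set x | exists y, [/\ word_ball X m y &
    x = y \/ exists2 z, z \in X & x = z * y]] else [set 1].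

Lemma finite_word_ball X n : finite_set (word_ball X n).
Proof.
elim: n => [|n IH] /=; first exact: finite_set1.
have : finite_set (word_ball X n `|`
   [set z * y | z in [set` X] & y in word_ball X n]).
  by rewrite finite_setU; split=> //; exact: finite_image2.
apply: sub_finite_set => x [y [hy [->|[z zX ->]]]]; [by left|right].
by exists z => //; exists y.
Qed.

Lemma word_prod_ball X s n : (forall x, x \in s -> x \in X) -> (size s <= n)%N ->
  word_ball X n (word_prod s).
Proof.
elim: n s => [|n IH] [|x s]//= sX hs.
  by exists 1; split; [apply: (IH [::])|left].
exists (word_prod s); split; last by right; exists x => //; apply: sX; rewrite mem_head.
by apply: IH => // y ys; apply: sX; rewrite inE ys orbT.
Qed.

(** A word with more than |X| (n - 1) letters contains some letter [n] times. Pulled to the front,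
    these copies cancel, so words of bounded length suffice. After the case analysis [n] stands for
    the exponent minus one. *)
Lemma dietzmann X n : (0 < n)%N -> (forall x y, x \in X -> y \in X -> x ^ y \in X) ->
  (forall x, x \in X -> x ^+ n = 1) ->
  finite_set [set word_prod s | s in [set s : seq G | forall x, x \in s -> x \in X]].
Proof.
case: n => // n _ XJ Xn.
apply: sub_finite_set (finite_word_ball X (size X * n)).
move=> _ [s sX <-]; have [k] := ubnP (size s); elim: k s sX => // k IH s sX sk.
have [h|h] := leqP (size s) (size X * n); first exact: word_prod_ball.
have [y yX hy] := pigeonhole_count sX h.
have [t [-> tsz tX]] := word_prod_pull (fun x xX => XJ x y xX yX) sX hy.
rewrite Xn// mul1g; apply: IH => //; lia.
Qed.

(** The conjugates of [x] are finitely many torsion elements; by [dietzmann] they generate a finite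
    normal subgroup, which is trivial in a prime group. *)
Lemma finite_class_torsion x n : prime_group G -> finite_set (conj_class x) ->
  (0 < n)%N -> x ^+ n = 1 -> x = 1.
Proof.
move=> prG fin n0 xn; have [X uX XE] := finite_uniq_seq fin.
have XJ g y : y \in X -> y ^ g \in X.
  by move=> /XE[h _ <-]; apply/XE; exists (h * g); rewrite // conjgM.
have Xn y : y \in X -> y ^+ n = 1 by move=> /XE[h _ <-]; rewrite -conjXg xn conj1g.
pose W : set G := [set word_prod s | s in [set s : seq G | forall x, x \in s -> x \in X]].
have W1 : W 1 by exists [::].
have WM y z : W y -> W z -> W (y * z).
  move=> [s sX <-] [t tX <-]; exists (s ++ t); last exact: word_prod_cat.
  by move=> u; rewrite mem_cat => /orP[/sX|/tX].
have WX y m : y \in X -> W (y ^+ m).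
  move=> yX; elim: m => [|m IH] //; rewrite expgS; apply: WM => //.
  by exists [:: y]; rewrite /= ?mulg1// => u; rewrite inE => /eqP ->.
have WV y : W y -> W y^-1.
  move=> [s sX <-]; elim: s sX => [|z s IH] sX /=; first by rewrite invg1.
  rewrite invgM; apply: WM; first by apply: IH => u us; apply: sX; rewrite inE us orbT.
  have zX : z \in X by apply: sX; rewrite mem_head.
  (* Words contain no inverse letters; torsion supplies them as powers. *)
  rewrite (_ : z^-1 = z ^+ n.-1); first exact: WX.
  by apply: mulg1_eq; rewrite -expgS prednK// Xn.
have WJ y g : W y -> W (y ^ g).
  move=> [s sX <-]; exists [seq z ^ g | z <- s]; last exact: word_prodJ.
  by move=> _ /mapP[z zs ->]; apply: XJ; exact: sX.
pose P : {pred G} := [pred y | `[< W y >]].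
have PM : mulg_closed P by move=> y z /asboolP Wy /asboolP Wz; apply/asboolP; exact: WM.
have P1 : 1 \in P by apply/asboolP.
have PV : invg_closed P by move=> y /asboolP Wy; apply/asboolP; exact: WV.
pose cM := isMulClosed.Build G P PM.
pose c1 := isMul1Closed.Build G P P1.
pose cV := isInvClosed.Build G P PV.
pose N : groupClosed G := HB.pack P cM c1 cV.
apply: (prG N).
- by move=> y g /asboolP Wy; apply/asboolP; exact: WJ.
- apply: sub_finite_set (dietzmann n0 (fun y z yX _ => XJ z y yX) Xn).
  by move=> y /= /asboolP.
- apply/asboolP; rewrite -[x]expg1; apply: WX; apply/XE; exists 1; rewrite ?conjg1//.
Qed.

End Words.

(** * Kleppner's condition for normal subgroups *)

Section SubgroupClasses.
Local Open Scope group_scope.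
Variables (G : groupType) (H : groupClosed G).
Implicit Types (x y z k : G) (s : seq G).

(** Only the conjugators are confined to [H]: regular elements of [G] outside [H] occur in
    [kleppner_of_sub]. *)
Definition sub_class x : set G := [set x ^ k | k in [set k | k \in H]].

Lemma sub_class_refl x : sub_class x x.
Proof. by exists 1; rewrite ?conjg1//=; exact: gpred1. Qed.

Lemma sub_classS x : sub_class x `<=` conj_class x.
Proof. by move=> _ [k _ <-]; exists k. Qed.

Lemma finite_sub_classX x n : finite_set (sub_class x) -> finite_set (sub_class (x ^+ n)).
Proof.
move=> /(finite_image (fun y => y ^+ n)); apply: sub_finite_set => _ [k kH <-].
by exists (x ^ k); rewrite ?conjXg//; exists k.
Qed.

Lemma finite_sub_classM x y : finite_set (sub_class x) -> finite_set (sub_class y) ->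
  finite_set (sub_class (x * y)).
Proof.
move=> fx fy; have := finite_image2 (fun a b : G => a * b) fx fy.
apply: sub_finite_set => _ [k kH <-]; rewrite conjMg.
by exists (x ^ k); [exists k|exists (y ^ k); [exists k|]].
Qed.

Lemma finite_sub_classV x : finite_set (sub_class x) -> finite_set (sub_class x^-1).
Proof.
move=> /(finite_image (fun y => y^-1)); apply: sub_finite_set => _ [k kH <-].
by exists (x ^ k); rewrite ?conjVg//; exists k.
Qed.

(** Among k^0, ..., k^|X| two powers conjugate [x] to the same element. So some k^d with 0 < d <=
    |X| commutes with [x], and d divides the factorial of |X|. *)
Lemma uniform_power x : finite_set (sub_class x) ->
  exists2 n, (0 < n)%N & forall k, k \in H -> commute x (k ^+ n).
Proof.
move=> /finite_uniq_seq[X uX XE]; exists (size X)`!; first exact: fact_gt0.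
move=> k kH; pose s := [seq x ^ (k ^+ i) | i <- iota 0 (size X).+1].
have sX : {subset s <= X}.
  by move=> _ /mapP[i _ ->]; apply/XE; exists (k ^+ i) => //=; exact: gpredXn.
have : ~~ uniq s.
  by apply/negP => us; have := uniq_leq_size us sX; rewrite size_map size_iota ltnn.
move=> /(uniqPn 1)[i [j [ij]]]; rewrite size_map size_iota => jX.
have iX := ltn_trans ij jX.
rewrite !(nth_map 0%N) ?size_iota// !nth_iota// !add0n => e.
have cj : commute x (k ^+ (j - i)).
  apply: conjg_commute; rewrite expgnFr ?(ltnW ij)// conjgM -e -conjgM.
  by rewrite mulgV conjg1.
have /dvdnP[d ->] : (j - i %| (size X)`!)%N by rewrite dvdn_fact//; lia.
by rewrite mulnC expgnA; exact: commuteX.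
Qed.

Lemma uniform_power_seq s : (forall x, x \in s -> finite_set (sub_class x)) ->
  exists2 n, (0 < n)%N & forall k x, k \in H -> x \in s -> commute x (k ^+ n).
Proof.
elim: s => [|x s IH] fs; first by exists 1%N.
have [n n0 nx] := uniform_power (fs x (mem_head x s)).
have [|m m0 ms] := IH; first by move=> y ys; apply: fs; rewrite inE ys orbT.
exists (n * m)%N; first by rewrite muln_gt0 n0.
move=> k y kH; rewrite inE => /orP[/eqP ->|ys].
  by rewrite expgnA; apply: commuteX; exact: nx.
by rewrite mulnC expgnA; apply: commuteX; exact: ms.
Qed.

(* [x ^+ m] is the power of [x] with the fewest conjugates. *)
Lemma stable_power x : finite_set (sub_class x) ->
  exists2 m, (0 < m)%N & forall n k, (0 < n)%N -> k \in H ->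
    commute (x ^+ (m * n)) k -> commute (x ^+ m) k.
Proof.
move=> fx.
have cl m : {X : seq G | uniq X /\ forall y, y \in X <-> sub_class (x ^+ m) y}.
  by apply: cid; have [X] := finite_uniq_seq (finite_sub_classX m fx); exists X.
pose c m := size (sval (cl m)).
pose P v := `[< exists2 m, (0 < m)%N & c m = v >].
have exP : exists v, P v by exists (c 1%N); apply/asboolP; exists 1%N.
have [v /asboolP[m m0 cm] vmin] := ex_minnP exP.
exists m => // n k n0 kH ck.
have mn0 : (0 < m * n)%N by rewrite muln_gt0 m0.
have cmn : (c m <= c (m * n))%N by rewrite cm; apply: vmin; apply/asboolP; exists (m * n)%N.
move: cmn; rewrite /c; case: (cl m) (cl (m * n)%N) => [X [uX XE]] [Y [uY YE]] /= XY.
(* The [n]-th power maps the class of x^m onto that of x^(mn), which is not smaller by minimality;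
   so it is injective. Hence if [k] fixes x^(mn), it fixes x^m. *)
have sub : {subset Y <= [seq y ^+ n | y <- X]}.
  move=> y /YE[h hH <-]; rewrite expgnA conjXg; apply: map_f.
  by apply/XE; exists h.
have u : uniq [seq y ^+ n | y <- X] by apply: leq_size_uniq uY sub _; rewrite size_map.
have inj : {in X &, injective (fun y : G => y ^+ n)}.
  move=> y z yX zX /= yz; have /(nthP 1)[i iX iy] := yX; have /(nthP 1)[j jX jz] := zX.
  rewrite -iy -jz; congr nth.
  apply: (uniqP 1 u); rewrite ?inE ?size_map//.
  by rewrite !(nth_map 1)// iy jz.
apply: conjg_commute; apply: inj.
- by apply/XE; exists k.
- by apply/XE; exact: sub_class_refl.
- by rewrite /= -conjXg -expgnA commute_conjg.
Qed.

Lemma finite_sub_class_val (x : subgrp H) :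
  finite_set (sub_class (val x)) <-> finite_set (conj_class x).
Proof.
split=> [fx|/(finite_image val)]; last first.
  apply: sub_finite_set => _ [k kH <-]; exists (x ^ SubGrp kH) => //.
  by exists (SubGrp kH).
have := finite_image (fun y => insubd x y) fx; apply: sub_finite_set => _ [k _ <-].
exists (val (x ^ k)); last exact: valKd.
by exists (val k) => //=; exact: subgrp_valP.
Qed.

Lemma finite_sub_class_torsion x n : prime_group (subgrp H) -> x \in H ->
  finite_set (sub_class x) -> (0 < n)%N -> x ^+ n = 1 -> x = 1.
Proof.
move=> prH xH fx n0 xn; pose y := SubGrp xH.
have valX m : val (y ^+ m) = x ^+ m.
  by elim: m => [|m IH] //; rewrite !expgS -IH.
have : y = 1.
  apply: (finite_class_torsion prH (n := n)) => //; first exact/finite_sub_class_val.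
  by apply: val_inj; rewrite valX xn.
by move=> /(congr1 val).
Qed.

End SubgroupClasses.

(** * Regular elements and the passage between [G] and its normal subgroups *)

Section Regularity.
Variables (R : realType) (G : groupType) (sigma : two_cocycle R G).
Implicit Types (x y z k g h : G) (s : seq G).
Local Notation tw := (twist sigma).

Definition sub_kleppner (H : groupClosed G) : Prop :=
  forall x, x \in H -> x != 1%g -> finite_set (sub_class H x) ->
    exists h, [/\ h \in H, commute x h & tw h x != 1].

Lemma kleppner_restr (H : groupClosed G) :
  kleppner (cocycle_restr sigma H) <-> sub_kleppner H.
Proof.
have twE (h x : subgrp H) : twist (cocycle_restr sigma H) h x = tw (val h) (val x) by [].
split=> K x.
  move=> xH x1 fx; have [||h [ch th]] := K (SubGrp xH).
  - by apply: contra x1 => /eqP/(congr1 val)/= ->.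
  - exact/finite_sub_class_val.
  exists (val h); split=> //; first exact: subgrp_valP.
  by have := congr1 val ch.
move=> x1 fx; have [|||h [hH ch th]] := K (val x).
- exact: subgrp_valP.
- by apply: contra x1 => /eqP e; apply/eqP; apply: val_inj.
- exact/finite_sub_class_val.
by exists (SubGrp hH); split=> //; apply: val_inj.
Qed.

Lemma twist_1r k : tw k 1%g = 1.
Proof. by rewrite twist_commuteE ?cocycle_g1 ?cocycle_1g ?invr1 ?mulr1// /commute mulg1 mul1g. Qed.

Lemma twist_expr k x n : commute x k -> tw k (x ^+ n)%g = tw k x ^+ n.
Proof.
move=> c; elim: n => [|n IH]; first by rewrite expg0 twist_1r.
rewrite expgS twist_mulr_commute// ?IH ?exprS//.
by apply: commute_sym; apply: commuteX; apply: commute_sym.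
Qed.

Lemma twist_expl k x n : commute x k -> tw (k ^+ n)%g x = tw k x ^+ n.
Proof.
move=> c; elim: n => [|n IH]; first by rewrite expg0 twist1.
by rewrite expgS twistM_commute// ?IH ?exprS//; exact: commuteX.
Qed.

Lemma twistVr k x : commute x k -> tw k x = 1 -> tw k x^-1%g = 1.
Proof.
move=> c e; have := @twist_mulr_commute _ _ sigma k x x^-1%g c.
rewrite mulgV twist_1r e mul1r => <-//.
by apply: commute_sym; apply: commuteV; apply: commute_sym.
Qed.

Lemma commute_word k s : (forall x, x \in s -> commute x k) -> commute (word_prod s) k.
Proof.
elim: s => [|x s IH] sk /=; first by rewrite /commute mul1g mulg1.
apply: commute_sym; apply: commuteM; apply: commute_sym.
  by apply: sk; rewrite mem_head.
by apply: IH => y ys; apply: sk; rewrite inE ys orbT.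
Qed.

Lemma twist_word k s : (forall x, x \in s -> commute x k /\ tw k x = 1) ->
  tw k (word_prod s) = 1.
Proof.
elim: s => [|x s IH] sk /=; first exact: twist_1r.
have ss : forall y, y \in s -> commute y k /\ tw k y = 1.
  by move=> y ys; apply: sk; rewrite inE ys orbT.
have [cx tx] := sk x (mem_head x s).
rewrite twist_mulr_commute// ?tx ?mul1r; first exact: IH.
by apply: commute_word => y /ss[].
Qed.

Definition regular_in (H : groupClosed G) x :=
  forall k, k \in H -> commute x k -> tw k x = 1.

(* With [w = z^m] as in [stable_power], [tw k (w^n) = (tw k w)^n = tw (k^n) w],
   and [k^n] commutes with all the letters. *)
Lemma regular_power (H : groupClosed G) s :
  (forall x, x \in s -> finite_set (sub_class H x) /\ regular_in H x) ->
  finite_set (sub_class H (word_prod s)) ->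
  exists2 n, (0 < n)%N & regular_in H (word_prod s ^+ n)%g.
Proof.
move=> Hs fz; have [m m0 mz] := stable_power fz.
have [n n0 nz] : exists2 n, (0 < n)%N &
    forall k x, k \in H -> x \in s -> commute x (k ^+ n)%g.
  by apply: uniform_power_seq => x /Hs[].
exists (m * n)%N; first by rewrite muln_gt0 m0.
move=> k kH /(mz n k n0 kH) c; rewrite expgnA twist_expr// -twist_expl//.
have knH : (k ^+ n)%g \in H by exact: gpredXn.
have kns x : x \in s -> commute x (k ^+ n)%g /\ tw (k ^+ n)%g x = 1.
  by move=> xs; have cx := nz k x kH xs; split=> //; apply: (Hs x xs).2.
rewrite twist_expr; first by rewrite twist_word// expr1n.
by apply: commute_word => x /kns[].
Qed.

Lemma regular_eltP (H : groupClosed G) x : sigma_regular_elt sigma (mem H) x <-> regular_in H x.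
Proof.
split=> h k kH c; first by apply/twist_eq1 => //; exact: h.
by apply/twist_eq1 => //; exact: h.
Qed.

Lemma regular_elt_predT x :
  sigma_regular_elt sigma predT x <-> forall k, commute x k -> tw k x = 1.
Proof.
split=> h k; first by move=> c; apply/twist_eq1 => //; exact: h.
by move=> _ c; apply/twist_eq1 => //; exact: h.
Qed.

Lemma regular_conj x g : (forall k, commute x k -> tw k x = 1) ->
  forall k, commute (x ^ g)%g k -> tw k (x ^ g)%g = 1.
Proof.
move=> h k c; rewrite -(conjgKV g k).
have ck : commute x (k ^ g^-1)%g.
  have := congr1 (fun y => y ^ g^-1)%g c.
  by rewrite (conjMg (x ^ g)%g k) (conjMg k (x ^ g)%g) conjgK.
by rewrite twistJ//; exact: h.
Qed.

Lemma twisted_centralizerP (H : groupClosed G) g :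
  g \in twisted_centralizer_group sigma H <->
  forall h, h \in H -> commute g h /\ tw h g = 1.
Proof.
split=> [/asboolP C h hH|C].
  by have [c s] := C h hH; split=> //; apply/twist_eq1.
by apply/asboolP => h hH; have [c s] := C h hH; split=> //; apply/twist_eq1.
Qed.

Lemma twisted_centralizer_normal (H : groupClosed G) :
  is_normal H -> is_normal (twisted_centralizer_group sigma H).
Proof.
move=> nH x g /twisted_centralizerP C; apply/twisted_centralizerP => h hH.
have [c t] := C _ (nH h g^-1%g hH).
have e : h = ((h ^ g^-1) ^ g)%g by rewrite conjgKV.
by split; [rewrite e /commute -!conjMg c|rewrite e twistJ].
Qed.

(** An element of [H] violating the condition is regular with respect to [G] by [sigma_regular]. The
    normal subgroup [N] generated by the elements of this kind is shown to be trivial by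
    [FC_ind]. *)
Lemma sub_kleppner_regular (H : groupClosed G) : FC_hypercentral G -> is_normal H ->
  prime_group (subgrp H) -> sigma_regular sigma H -> kleppner sigma -> sub_kleppner H.
Proof.
move=> FCG nH prH rH K h0 h0H h01 fh0; apply: contrapT => nk.
have rh0 : regular_in H h0.
  by move=> k kH c; apply/eqP/negP => /negP t; apply: nk; exists k.
pose S y := [/\ y \in H, finite_set (sub_class H y) & forall k, commute y k -> tw k y = 1].
have Sh0 : S h0.
  by split=> //; apply/regular_elt_predT; apply: rH => //; apply/regular_eltP.
have SV y : S y -> S y^-1%g.
  move=> [yH fy ty]; split; rewrite ?gpredV//; first exact: finite_sub_classV.
  move=> k c; have c' : commute y k.
    by apply: commute_sym; rewrite -[y]invgK; apply: commuteV; apply: commute_sym.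
  by apply: twistVr => //; exact: ty.
have SJ y g : S y -> S (y ^ g)%g.
  move=> [yH fy ty]; split; [exact: nH| |exact: regular_conj].
  have := finite_image (fun z => z ^ g)%g fy; apply: sub_finite_set => _ [k kH <-].
  exists (y ^ (k ^ g^-1))%g; first by exists (k ^ g^-1)%g => //=; exact: nH.
  by rewrite -{2}(conjgKV g k) conjJg.
pose N : set G := [set word_prod s | s in [set s : seq G | forall x, x \in s -> S x]].
have NM x y : N x -> N y -> N (x * y)%g.
  move=> [s sS <-] [t tS <-]; exists (s ++ t); last exact: word_prod_cat.
  by move=> u; rewrite mem_cat => /orP[/sS|/tS].
have NV x : N x -> N x^-1%g.
  move=> [s sS <-]; elim: s sS => [|z s IH] sS /=.
    by rewrite invg1; exists [::].
  rewrite invgM; apply: NM; first by apply: IH => u us; apply: sS; rewrite inE us orbT.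
  exists [:: z^-1%g]; last by rewrite /= mulg1.
  by move=> u; rewrite inE => /eqP ->; apply: SV; apply: sS; rewrite mem_head.
have NJ x g : N x -> N (x ^ g)%g.
  move=> [s sS <-]; exists [seq z ^ g | z <- s]%g; last exact: word_prodJ.
  by move=> _ /mapP[z zs ->]; apply: SJ; exact: sS.
have NH x : N x -> x \in H.
  move=> [s sS <-]; elim: s sS => [|z s IH] sS /=; first exact: gpred1.
  rewrite gpredM//; first by have [] := sS z (mem_head z s).
  by apply: IH => u us; apply: sS; rewrite inE us orbT.
suff N1 : forall x, N x -> x = 1%g.
  move/eqP: h01; apply; apply: N1; exists [:: h0]; last by rewrite /= mulg1.
  by move=> u; rewrite inE => /eqP ->.
apply: FC_ind => // L nL L1 x xL Nx.
have fx : finite_set (conj_class x).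
  (* Two conjugates of [x] congruent modulo [L] differ by an element of both [L] and [N], hence
     coincide; so finiteness modulo [L] becomes finiteness of the class in [G]. *)
  have := @finite_range_class_mod G L x G G id (fun g => x ^ g)%g nL xL.
  case=> [i j h|].
    have := L1 _ h (NM _ _ (NV _ (NJ _ i Nx)) (NJ _ j Nx)).
    by move=> /mulg1_eq; rewrite invgK.
  by move=> n hn; exists n.
apply/eqP/negP => /negP x1.
have xH := NH x Nx; case: Nx => s sS xs.
have fxH : finite_set (sub_class H x) by apply: sub_finite_set fx; exact: sub_classS.
have [n n0 rn] : exists2 n, (0 < n)%N & regular_in H (x ^+ n)%g.
  rewrite -xs; apply: regular_power; last by rewrite xs.
  by move=> y /sS[yH fy ty]; split=> // k kH; exact: ty.
have xnH : (x ^+ n)%g \in H by exact: gpredXn.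
(* Sigma-regularity lifts the regularity of the power from [H] to [G], where its class is finite and
   Kleppner's condition can be contradicted. *)
have := rH _ xnH; move=> /(_ _)/regular_elt_predT rxn.
have xn1 : (x ^+ n)%g != 1%g.
  by apply: contra x1 => /eqP /(finite_sub_class_torsion prH xH fxH n0) ->.
have [|h [ch]] := K _ xn1.
  have := finite_image (fun y => y ^+ n)%g fx; apply: sub_finite_set => _ [k _ <-].
  by exists (x ^ k)%g; rewrite ?conjXg//; exists k.
rewrite rxn ?eqxx//; exact/regular_eltP.
Qed.

Lemma kleppner_of_sub (H : groupClosed G) : is_normal H -> prime_group (subgrp H) ->
  sub_kleppner H -> sub_kleppner (twisted_centralizer_group sigma H) -> kleppner sigma.
Proof.
move=> nH prH KH KC x x1 fx; apply: contrapT => nk.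
have rx k : commute x k -> tw k x = 1.
  by move=> c; apply/eqP/negP => /negP t; apply: nk; exists k.
have fsub (L : groupClosed G) : finite_set (sub_class L x).
  by apply: sub_finite_set fx; exact: sub_classS.
have xJ h : h \in H -> (x ^ h)%g = x.
  move=> hH; pose z := word_prod [:: x^-1; x ^ h]%g.
  have zE : z = (x^-1 * x ^ h)%g by rewrite /z /= mulg1.
  have zH : z \in H.
    (* The commutator of [x] and [h] is also a product of two elements of the normal subgroup
       [H]. *)
    rewrite zE (_ : _ * _ = (h^-1) ^ x * h)%g.
      by rewrite gpredM//; apply: nH; rewrite gpredV.
    by rewrite !conjgE !mulgA.
  have fxh : finite_set (sub_class H (x ^ h)%g).
    apply: sub_finite_set fx => _ [k kH <-]; exists (h * k)%g => //.
    by rewrite conjgM.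
  have fz : finite_set (sub_class H z).
    by rewrite zE; apply: finite_sub_classM => //; apply: finite_sub_classV.
  have [n n0 rn] : exists2 n, (0 < n)%N & regular_in H (z ^+ n)%g.
    apply: regular_power fz => y; rewrite !inE => /orP[/eqP ->|/eqP ->].
      split; first exact: finite_sub_classV.
      move=> k kH c; have c' : commute x k.
        by apply: commute_sym; rewrite -[x]invgK; apply: commuteV; apply: commute_sym.
      by apply: twistVr => //; exact: rx.
    by split=> // k kH; exact: regular_conj.
  (* A power of [z] different from 1 would contradict Kleppner's condition for [H]. So [z] is
     torsion with a finite class, hence 1, and [x] commutes with [h]. *)
  have [zn1|zn1] := eqVneq (z ^+ n)%g 1%g.
    have := finite_sub_class_torsion prH zH fz n0 zn1; rewrite zE => /mulg1_eq.
    by rewrite invgK.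
  have [||k [kH ck]] := KH _ _ zn1; first exact: gpredXn.
    exact: finite_sub_classX.
  by rewrite rn ?eqxx.
(* Now [x] centralizes [H] and is regular, so it lies in the twisted centralizer and violates the
   condition there. *)
have xC : x \in twisted_centralizer_group sigma H.
  apply/twisted_centralizerP => h hH; have c := conjg_commute (xJ h hH).
  by split=> //; exact: rx.
have [|h [_ ch]] := KC x xC x1; first exact: fsub.
by rewrite rx ?eqxx.
Qed.

End Regularity.

Theorem corollary9p7 (R : realType) (G : groupType) (sigma : two_cocycle R G)
    (H : groupClosed G)
    (FCG : FC_hypercentral G)
    (normalH : is_normal H)
    (primeH : prime_group (subgrp H))
    (regularH : sigma_regular sigma H) :
  let C := twisted_centralizer_group sigma H in
  (Cstar_simple (cocycle_restr sigma H) /\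
     Cstar_simple (cocycle_restr sigma C) ->
   Cstar_simple sigma) /\
  (prime_group (subgrp C) -> sigma_regular sigma C ->
   Cstar_simple sigma ->
   Cstar_simple (cocycle_restr sigma H) /\
     Cstar_simple (cocycle_restr sigma C)).
Proof.
move=> C; split=> [[/simple_kleppner/kleppner_restr KH /simple_kleppner/kleppner_restr KC]|].
  by apply: kleppner_simple => //; exact: kleppner_of_sub KC.
move=> primeC regularC /simple_kleppner K.
(* Both subgroups inherit FC-hypercentrality from [G], and [C] is normal because [H] is, so the same
   lemma serves for both. *)
split; apply: kleppner_simple; try exact: FC_hypercentral_sub.
  by apply/kleppner_restr; exact: sub_kleppner_regular.
apply/kleppner_restr; apply: sub_kleppner_regular => //.
exact: twisted_centralizer_normal.
Qed.
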